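(* Let $F$ be a field of characteristic zero, let $E$ be the Grassmann algebra over $F$ of a vector space with countably infinite basis $\{e_1,e_2,\dots\}$, and let $k\geq 1$ be an integer. Then the algebra $M_k(E)$ has the primeness property on central polynomials, and the algebra $M_{k,k}(E)$ has the primeness property on central polynomials.
   Context: All algebras are associative algebras over $F$. $F\langle X\rangle$ is the free associative algebra on $X=\{x_1,x_2,\dots\}$. A polynomial $f(x_1,\dots,x_n)\in F\langle X\rangle$ is an identity for an algebra $A$ if $f(a_1,\dots,a_n)=0$ for all $a_1,\dots,a_n\in A$; it is a central polynomial for $A$ if $f(a_1,\dots,a_n)\in Z(A)$ (the center of $A$) for all $a_1,\dots,a_n\in A$; it is a proper central polynomial for $A$ if it is a central polynomial for $A$ and not an identity for $A$. An algebra $A$ has the primeness property on central polynomials if there exist proper central polynomials for $A$ and, whenever $f(x_1,\dots,x_r)$ and $g(x_{r+1},\dots,x_s)$ are polynomials in disjoint sets of variables such that $f\cdot g$ is a proper central polynomial for $A$, both $f$ and $g$ are proper central polynomials for $A$. The Grassmann algebra is the unital algebra $E=\langle 1,e_1,e_2,\dots \mid e_ie_j=-e_je_i \text{ for all } i,j\geq 1\rangle$, with basis $\{1\}\cup\{e_{i_1}\cdots e_{i_m} : m\ge 1,\ i_1<\dots<i_m\}$. Let $E_0$ be the span of $1$ and the basis monomials of even length $m$, and $E_1$ the span of the basis monomials of odd length $m$. $M_k(E)$ is the algebra of $k\times k$ matrices over $E$. $M_{k,k}(E)$ is the subalgebra of $M_{2k}(E)$ consisting of the block matrices $\begin{pmatrix}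 a & c\\ d& b\end{pmatrix}$ where $a,b$ are $k\times k$ matrices with entries in $E_0$ and $c,d$ are $k\times k$ matrices with entries in $E_1$. *)

(* Defs.v *)
From HB Require Import structures.
From mathcomp Require Import all_boot all_order all_algebra.
From mathcomp Require Import finmap.
From mathcomp.multinomials Require Import monalg.

Set Implicit Arguments.
Unset Strict Implicit.
Unset Printing Implicit Defensive.

Import Order.TTheory GRing.Theory.
Local Open Scope ring_scope.

(* The library regards 'M[A]_n as a module over A, so the F-algebra structure *)
(* of matrices over an F-algebra A is put on an alias.  Unital rings have to  *)
(* be nontrivial: matalg A n consists of the matrices of size k = n.+1 >= 1.  *)

Definition matalg (F : fieldType) (A : algType F) (n : nat) : Type :=
  'M[A]_n.+1.

Section MatAlg.
Variables (F : fieldType) (A : algType F) (n : nat).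

HB.instance Definition _ := GRing.NzRing.on (matalg A n).

Implicit Types (c d : F) (M N : matalg A n).

Definition matalg_scale c M : matalg A n :=
  \matrix_(i < n.+1, j < n.+1) (c *: (M : 'M[A]_n.+1) i j).

Fact matalg_scaleA c d M :
  matalg_scale c (matalg_scale d M) = matalg_scale (c * d) M.
Proof. by apply/matrixP=> i j; rewrite !mxE scalerA. Qed.

Fact matalg_scale1 : left_id 1 matalg_scale.
Proof. by move=> M; apply/matrixP=> i j; rewrite !mxE scale1r. Qed.

Fact matalg_scaleDr : right_distributive matalg_scale +%R.
Proof. by move=> c M N; apply/matrixP=> i j; rewrite !mxE scalerDr. Qed.

Fact matalg_scaleDl M : {morph matalg_scale^~ M : c d / c + d}.
Proof. by move=> c d; apply/matrixP=> i j; rewrite !mxE scalerDl. Qed.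

HB.instance Definition _ := GRing.Zmodule_isLmodule.Build F (matalg A n)
  matalg_scaleA matalg_scale1 matalg_scaleDr matalg_scaleDl.

Fact matalg_scaleAl c M N : c *: (M * N) = (c *: M) * N.
Proof.
apply/matrixP=> i j; rewrite !mxE scaler_sumr.
by apply: eq_bigr => k _; rewrite mxE scalerAl.
Qed.

HB.instance Definition _ := GRing.Lmodule_isLalgebra.Build F (matalg A n)
  matalg_scaleAl.

Fact matalg_scaleAr c M N : c *: (M * N) = M * (c *: N).
Proof.
apply/matrixP=> i j; rewrite !mxE scaler_sumr.
by apply: eq_bigr => k _; rewrite mxE scalerAr.
Qed.

HB.instance Definition _ := GRing.Lalgebra_isAlgebra.Build F (matalg A n)
  matalg_scaleAr.

End MatAlg.

(* The Grassmann algebra is built on the basis indexed by finite sets, where  *)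
(* S = {i_1 < ... < i_m} stands for e_{i_1} ... e_{i_m}.  Sorting the product *)
(* of the monomials of two disjoint sets S and T takes one transposition for  *)
(* each pair (s, t) of S x T with t < s.  The generators are numbered from 0. *)
(* See gr_genC, gr_mon_prod and grassmannE for the usual presentation.        *)

Definition gr_inv (S T : {fset nat}) : nat :=
  (\sum_(s <- S) \sum_(t <- T) (t < s))%N.

Definition gr_sign (R : pzRingType) (S T : {fset nat}) : R :=
  if [disjoint S & T]%fset then (-1) ^+ gr_inv S T else 0.

Definition grassmann (F : fieldType) : Type := {malg F[{fset nat}]}.

Section Grassmann.
Variable F : fieldType.

HB.instance Definition _ := GRing.Lmodule.on (grassmann F).

Local Notation E := (grassmann F).
Local Notation sg := (gr_sign F).
Implicit Types (x y z : E) (S T U : {fset nat}).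

Definition gr_mon S : E := << S >>.
Definition gr_gen (i : nat) : E := gr_mon [fset i]%fset.

Definition gr_mul x y : E :=
  \sum_(S <- msupp x) \sum_(T <- msupp y)
     << x@_S * y@_T * sg S T *g (S `|` T)%fset >>.

Fact perm_fsetU S T : [disjoint S & T]%fset -> perm_eq (S `|` T)%fset (S ++ T).
Proof.
move=> /fdisjointP dST; apply: uniq_perm; rewrite ?fset_uniq //.
  rewrite cat_uniq !fset_uniq /= andbT; apply/hasPn => i iT.
  by apply: contraL iT => /dST.
by move=> i; rewrite mem_cat in_fsetE.
Qed.

Fact gr_invUl S T U : [disjoint S & T]%fset ->
  gr_inv (S `|` T)%fset U = (gr_inv S U + gr_inv T U)%N.
Proof.
move=> dST; by rewrite /gr_inv (perm_big _ (perm_fsetU dST)) big_cat.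
Qed.

Fact gr_invUr S T U : [disjoint T & U]%fset ->
  gr_inv S (T `|` U)%fset = (gr_inv S T + gr_inv S U)%N.
Proof.
move=> dTU; rewrite /gr_inv -big_split /=; apply: eq_bigr => s _.
by rewrite (perm_big _ (perm_fsetU dTU)) big_cat.
Qed.

Fact gr_signA S T U :
  sg S T * sg (S `|` T)%fset U = sg S (T `|` U)%fset * sg T U.
Proof.
rewrite /gr_sign fdisjointUX fdisjointXU.
have [dST|] := boolP [disjoint S & T]%fset; last by rewrite !mul0r.
have [dSU|] := boolP [disjoint S & U]%fset; last by rewrite !(mul0r, mulr0).
have [dTU|] := boolP [disjoint T & U]%fset; last by rewrite !(mul0r, mulr0).
by rewrite -!exprD gr_invUl // gr_invUr // addnA.
Qed.

Fact gr_mulEw (d1 d2 : {fset {fset nat}}) x y :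
  (msupp x `<=` d1)%fset -> (msupp y `<=` d2)%fset ->
  gr_mul x y = \sum_(S <- d1) \sum_(T <- d2)
     << x@_S * y@_T * sg S T *g (S `|` T)%fset >>.
Proof.
move=> le1 le2; rewrite /gr_mul (big_fset_incl _ le1) /=.
  apply/eq_bigr=> S _; apply/big_fset_incl => // T _ /mcoeff_outdom ->.
  by rewrite mulr0 mul0r monalgU0.
move=> S _ /mcoeff_outdom xS.
by rewrite big1 // => T _; rewrite xS !mul0r monalgU0.
Qed.

Fact gr_mulUU c d S T :
  gr_mul << c *g S >> << d *g T >> = << c * d * sg S T *g (S `|` T)%fset >>.
Proof.
by rewrite (gr_mulEw msuppU_le msuppU_le) !big_seq_fset1 !mcoeffUU.
Qed.

Fact gr_mulDl : left_distributive gr_mul +%R.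
Proof.
move=> x y z.
have lx : (msupp x `<=` msupp x `|` msupp y)%fset by exact: fsubsetUl.
have ly : (msupp y `<=` msupp x `|` msupp y)%fset by exact: fsubsetUr.
rewrite (gr_mulEw (msuppD_le _ _) (fsubset_refl _)).
rewrite (gr_mulEw lx (fsubset_refl _)) (gr_mulEw ly (fsubset_refl _)).
rewrite -big_split /=; apply/eq_bigr=> S _.
rewrite -big_split /=; apply/eq_bigr=> T _.
by rewrite mcoeffD !mulrDl monalgUD.
Qed.

Fact gr_mulDr : right_distributive gr_mul +%R.
Proof.
move=> z x y.
have lx : (msupp x `<=` msupp x `|` msupp y)%fset by exact: fsubsetUl.
have ly : (msupp y `<=` msupp x `|` msupp y)%fset by exact: fsubsetUr.
rewrite (gr_mulEw (fsubset_refl _) (msuppD_le _ _)).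
rewrite (gr_mulEw (fsubset_refl _) lx) (gr_mulEw (fsubset_refl _) ly).
rewrite -big_split /=; apply/eq_bigr=> S _.
rewrite -big_split /=; apply/eq_bigr=> T _.
by rewrite mcoeffD mulrDr mulrDl monalgUD.
Qed.

Fact gr_mul0l : left_zero 0 gr_mul.
Proof. by move=> x; rewrite /gr_mul msupp0 big_seq_fset0. Qed.

Fact gr_mul0r : right_zero 0 gr_mul.
Proof.
by move=> x; rewrite /gr_mul big1 // => S _; rewrite msupp0 big_seq_fset0.
Qed.

Fact gr_mul_suml I (r : seq I) (G : I -> E) y :
  gr_mul (\sum_(i <- r) G i) y = \sum_(i <- r) gr_mul (G i) y.
Proof.
by apply: (big_morph (gr_mul^~ y)) => [u v|]; rewrite ?gr_mulDl ?gr_mul0l.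
Qed.

Fact gr_mul_sumr I (r : seq I) (G : I -> E) y :
  gr_mul y (\sum_(i <- r) G i) = \sum_(i <- r) gr_mul y (G i).
Proof. by apply: big_morph => [u v|]; rewrite ?gr_mulDr ?gr_mul0r. Qed.

Fact gr_mulA : associative gr_mul.
Proof.
move=> x y z; rewrite [x]monalgE.
rewrite [LHS]gr_mul_suml [X in _ = gr_mul X z]gr_mul_suml [RHS]gr_mul_suml.
apply: eq_bigr => S _; rewrite [y]monalgE.
rewrite [X in gr_mul _ X = _]gr_mul_suml [LHS]gr_mul_sumr.
rewrite [X in _ = gr_mul X z]gr_mul_sumr [RHS]gr_mul_suml.
apply: eq_bigr => T _; rewrite [z]monalgE.
rewrite [X in gr_mul _ X = _]gr_mul_sumr [LHS]gr_mul_sumr [RHS]gr_mul_sumr.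
apply: eq_bigr => U _.
rewrite !gr_mulUU fsetUA; congr << _ *g _ >>.
rewrite -!mulrA; congr (_ * (_ * _)); rewrite [RHS]mulrCA gr_signA.
by congr (_ * _); rewrite mulrC.
Qed.

Fact gr_signl0 S : sg fset0 S = 1.
Proof. by rewrite /gr_sign fdisjoint0X /gr_inv big_seq_fset0. Qed.

Fact gr_signr0 S : sg S fset0 = 1.
Proof.
rewrite /gr_sign fdisjointX0 /gr_inv big1 // => s _.
by rewrite big_seq_fset0.
Qed.

Fact gr_mul1l : left_id (gr_mon fset0) gr_mul.
Proof.
move=> x; rewrite [in LHS](monalgE x) [LHS]gr_mul_sumr [RHS]monalgE.
apply: eq_bigr => S _.
by rewrite gr_mulUU gr_signl0 fset0U mulr1 mul1r.
Qed.

Fact gr_mul1r : right_id (gr_mon fset0) gr_mul.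
Proof.
move=> x; rewrite [in LHS](monalgE x) [LHS]gr_mul_suml [RHS]monalgE.
apply: eq_bigr => S _.
by rewrite gr_mulUU gr_signr0 fsetU0 !mulr1.
Qed.

Fact gr_one_neq0 : gr_mon fset0 != 0.
Proof.
by apply/eqP => /malgP /(_ fset0) /eqP; rewrite mcoeffUU mcoeff0 oner_eq0.
Qed.

HB.instance Definition _ := GRing.Zmodule_isNzRing.Build (grassmann F)
  gr_mulA gr_mul1l gr_mul1r gr_mulDl gr_mulDr gr_one_neq0.

Fact gr_scaleU c d S : c *: (<< d *g S >> : E) = << c * d *g S >>.
Proof. by apply/malgP => T; rewrite mcoeffZ !mcoeffU mulrnAr. Qed.

Fact gr_scaleAl c x y : c *: (x * y) = (c *: x) * y.
Proof.
have -> : x * y = gr_mul x y by [].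
rewrite -[(c *: x) * y]/(gr_mul (c *: x) y).
rewrite (gr_mulEw (msuppZ_le c x) (fsubset_refl _)) scaler_sumr.
apply: eq_bigr => S _; rewrite scaler_sumr; apply: eq_bigr => T _.
by rewrite gr_scaleU mcoeffZ !mulrA.
Qed.

HB.instance Definition _ := GRing.Lmodule_isLalgebra.Build F (grassmann F)
  gr_scaleAl.

Fact gr_scaleAr c x y : c *: (x * y) = x * (c *: y).
Proof.
have -> : x * y = gr_mul x y by [].
rewrite -[x * (c *: y)]/(gr_mul x (c *: y)).
rewrite (gr_mulEw (fsubset_refl _) (msuppZ_le c y)) scaler_sumr.
apply: eq_bigr => S _; rewrite scaler_sumr; apply: eq_bigr => T _.
by rewrite gr_scaleU mcoeffZ [in RHS]mulrCA !mulrA.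
Qed.

HB.instance Definition _ := GRing.Lalgebra_isAlgebra.Build F (grassmann F)
  gr_scaleAr.

Lemma gr_monM S T : gr_mon S * gr_mon T = sg S T *: gr_mon (S `|` T)%fset.
Proof.
rewrite -[LHS]/(gr_mul (gr_mon S) (gr_mon T)) gr_mulUU /gr_mon gr_scaleU.
by rewrite !mul1r mulr1.
Qed.

Lemma gr_genC i j : gr_gen i * gr_gen j = - (gr_gen j * gr_gen i).
Proof.
rewrite !gr_monM -scaleNr [X in - _ *: gr_mon X]fsetUC; congr (_ *: _).
rewrite /gr_sign !fdisjoint1X !in_fset1 /gr_inv !big_seq_fset1.
by case: ltngtP => _ /=; rewrite ?(expr0, expr1, oppr0, opprK).
Qed.

Lemma gr_mon_prod (s : seq nat) :
  sorted ltn s -> gr_mon [fset i in s]%fset = \prod_(i <- s) gr_gen i.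
Proof.
elim: s => [_|i s IHs /= ltis].
  rewrite big_nil -[RHS]/(gr_mon fset0); congr gr_mon.
  by apply/fsetP => j; rewrite in_fset in_fset0.
rewrite big_cons -IHs ?(path_sorted ltis) // gr_monM.
have {}ltis : forall j, j \in s -> (i < j)%N.
  by apply/allP; apply: order_path_min ltis; apply: ltn_trans.
have -> : sg [fset i]%fset [fset j in s]%fset = 1.
  rewrite /gr_sign fdisjoint1X in_fset /=.
  have -> /= : i \notin s by apply/negP => /ltis; rewrite ltnn.
  rewrite /gr_inv big_seq_fset1 big_seq big1 // => j.
  by rewrite in_fset => /ltis /ltnW; rewrite leqNgt => /negbTE ->.
rewrite scale1r; congr gr_mon; apply/fsetP => j.
by rewrite !(in_fsetE, in_fset1, in_fset).
Qed.

Lemma grassmannE x : x = \sum_(S <- msupp x) x@_S *: gr_mon S.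
Proof.
by rewrite {1}[x]monalgE; apply: eq_bigr => S _; rewrite gr_scaleU mulr1.
Qed.

(* E_0 is gr_homog false and E_1 is gr_homog true. *)
Definition gr_homog (b : bool) : {pred E} :=
  [pred x : E | all (fun S : {fset nat} => odd #|` S| == b) (msupp x)].

Fact gr_homogP b x :
  reflect (forall S, odd #|` S| != b -> x@_S = 0) (x \in gr_homog b).
Proof.
apply: (iffP allP) => [xb S Sb|x0 S].
  by apply/eqP; rewrite mcoeff_eq0; apply: contra Sb => /xb.
by rewrite -mcoeff_neq0; apply: contraR => /x0 ->.
Qed.

Fact gr_homog_addr_closed b : addr_closed (gr_homog b).
Proof.
split=> [|x y /gr_homogP xb /gr_homogP yb]; apply/gr_homogP => S Sb.
  exact: mcoeff0.
by rewrite mcoeffD xb ?yb ?addr0.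
Qed.

HB.instance Definition _ b := GRing.isAddClosed.Build E (gr_homog b)
  (gr_homog_addr_closed b).

Fact gr_homogZ b c x : x \in gr_homog b -> c *: x \in gr_homog b.
Proof.
by move=> /gr_homogP xb; apply/gr_homogP => S Sb; rewrite mcoeffZ xb ?mulr0.
Qed.

Fact gr_homogM b c x y :
  x \in gr_homog b -> y \in gr_homog c -> x * y \in gr_homog (b (+) c).
Proof.
move=> /allP xb /allP yc; rewrite -[x * y]/(gr_mul x y) /gr_mul.
rewrite big_seq rpred_sum // => S /xb /eqP Sb.
rewrite big_seq rpred_sum // => T /yc /eqP Tc.
apply/gr_homogP => U Ubc; rewrite mcoeffU; case: eqP => [UE|//].
rewrite /gr_sign; case: ifP => [dST|_]; last by rewrite mulr0 mul0rn.
by move: Ubc; rewrite -UE cardfsU (eqP dST) cardfs0 subn0 oddD Sb Tc eqxx.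
Qed.

Fact gr_homog1 : 1 \in gr_homog false.
Proof.
apply/gr_homogP => S Sodd; rewrite -[1]/(gr_mon fset0) mcoeffU.
by case: (fset0 =P S) Sodd => [<-|_ _]; rewrite ?cardfs0 ?mulr0n.
Qed.

End Grassmann.

Arguments gr_homog F b : clear implicits.

(* supermat F n is M_{k,k}(E) for k = n.+1; the size (n + n.+1).+1 of the     *)
(* matrices is convertible to k + k.                                          *)

Definition block_even_odd (F : fieldType) (n : nat) :
    {pred matalg (grassmann F) (n + n.+1)} :=
  fun M => let B : 'M[grassmann F]_(n.+1 + n.+1) := M in
  [&& ulsubmx B \is a mxOver (gr_homog F false),
      drsubmx B \is a mxOver (gr_homog F false),
      ursubmx B \is a mxOver (gr_homog F true)
    & dlsubmx B \is a mxOver (gr_homog F true)].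

Arguments block_even_odd F n : clear implicits.

Section SuperMat.
Variables (F : fieldType) (n : nat).

Local Notation E := (grassmann F).

Fact block_even_oddP (M : matalg E (n + n.+1)) :
  reflect (forall i j : 'I_(n + n.+1).+1,
             (M : 'M[E]_((n + n.+1).+1)) i j
               \in gr_homog F ((i < n.+1)%N != (j < n.+1)%N))
          (M \in block_even_odd F n).
Proof.
set B : 'M[E]_(n.+1 + n.+1) := M.
have -> : (M \in block_even_odd F n) =
    [&& ulsubmx B \is a mxOver (gr_homog F false),
        drsubmx B \is a mxOver (gr_homog F false),
        ursubmx B \is a mxOver (gr_homog F true)
      & dlsubmx B \is a mxOver (gr_homog F true)] by [].
have ltl (i : 'I_n.+1) : (lshift n.+1 i < n.+1)%N by exact: (ltn_ord i).
have ltr (i : 'I_n.+1) : (rshift n.+1 i < n.+1)%N = false.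
  by rewrite /= ltnNge leq_addr.
suff E4 (i j : 'I_n.+1) :
  [/\ ulsubmx B i j = B (lshift n.+1 i) (lshift n.+1 j),
      drsubmx B i j = B (rshift n.+1 i) (rshift n.+1 j),
      ursubmx B i j = B (lshift n.+1 i) (rshift n.+1 j)
    & dlsubmx B i j = B (rshift n.+1 i) (lshift n.+1 j)].
  apply: (iffP and4P) => [[/mxOverP Bul /mxOverP Bdr /mxOverP Bur /mxOverP Bdl]|BE].
    suff BP (i j : 'I_(n.+1 + n.+1)) :
      B i j \in gr_homog F ((i < n.+1)%N != (j < n.+1)%N) by exact: BP.
    case: (split_ordP i) => i' ->; case: (split_ordP j) => j' ->;
      have [ul dr ur dl] := E4 i' j'; rewrite ?ltl ?ltr.
    - by rewrite -ul; exact: Bul.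
    - by rewrite -ur; exact: Bur.
    - by rewrite -dl; exact: Bdl.
    - by rewrite -dr; exact: Bdr.
  have BP (i j : 'I_(n.+1 + n.+1)) :
    B i j \in gr_homog F ((i < n.+1)%N != (j < n.+1)%N) by exact: BE.
  split; apply/mxOverP => i j; have [ul dr ur dl] := E4 i j.
  - by rewrite ul; have := BP (lshift n.+1 i) (lshift n.+1 j); rewrite !ltl.
  - by rewrite dr; have := BP (rshift n.+1 i) (rshift n.+1 j); rewrite !ltr.
  - by rewrite ur; have := BP (lshift n.+1 i) (rshift n.+1 j); rewrite ltl ltr.
  - by rewrite dl; have := BP (rshift n.+1 i) (lshift n.+1 j); rewrite ltl ltr.
by split; rewrite !mxE.
Qed.

Fact block_even_odd_closed : GRing.subsemialg_closed (block_even_odd F n).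
Proof.
split.
- apply/block_even_oddP => i j; rewrite mxE.
  by case: eqP => [->|_]; rewrite ?eqxx ?gr_homog1 ?rpred0.
- split=> [|M N /block_even_oddP MP /block_even_oddP NP].
    by apply/block_even_oddP => i j; rewrite mxE rpred0.
  by apply/block_even_oddP => i j; rewrite mxE rpredD ?MP ?NP.
- move=> c M /block_even_oddP MP.
  by apply/block_even_oddP => i j; rewrite mxE gr_homogZ ?MP.
- move=> M N /block_even_oddP MP /block_even_oddP NP.
  apply/block_even_oddP => i j; rewrite mxE rpred_sum // => k _.
  have -> : ((i < n.+1)%N != (j < n.+1)%N) =
      ((i < n.+1)%N != (k < n.+1)%N) (+) ((k < n.+1)%N != (j < n.+1)%N).
    by case: (i < _)%N (j < _)%N (k < _)%N => [] [] [].
  exact: gr_homogM.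
Qed.

Record supermat : predArgType := SuperMat {
  supermat_val :> matalg E (n + n.+1);
  _ : supermat_val \in block_even_odd F n
}.

HB.instance Definition _ := [isSub for supermat_val].
HB.instance Definition _ := [Choice of supermat by <:].
HB.instance Definition _ := GRing.SubChoice_isSubAlgebra.Build F
  (matalg E (n + n.+1)) (block_even_odd F n) supermat block_even_odd_closed.

End SuperMat.

(* The free associative algebra F<x_0, x_1, ...>, with unit. *)
Notation freealg F := {malg F[{fmonom nat}]}.

Definition in_vars (F : fieldType) (P : pred nat) (f : freealg F) : Prop :=
  forall m : {fmonom nat}, m \in msupp f -> all P m.

Definition no_constant_term (F : fieldType) (f : freealg F) : Prop :=
  f@_(mone : {fmonom nat}) = 0.

Section Polynomials.
Variables (F : fieldType) (A : algType F).
Implicit Types (f g : freealg F) (a : nat -> A).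

Definition fmeval a (m : {fmonom nat}) : A := \prod_(i <- m) a i.

Fact fmeval_mmorphism a : mmorphism (fmeval a).
Proof.
split=> [m1 m2|]; first by rewrite /fmeval fmM big_cat.
by rewrite /fmeval fm1 big_nil.
Qed.

HB.instance Definition _ a :=
  isMultiplicative.Build {fmonom nat} A (fmeval a) (fmeval_mmorphism a).

Definition peval a f : A := mmap (in_alg A) (fmeval a) f.

Lemma peval_var a i : peval a << fmu i >> = a i.
Proof. by rewrite /peval mmapU /fmeval fmU big_seq1 /= scale1r mul1r. Qed.

Lemma pevalD a f g : peval a (f + g) = peval a f + peval a g.
Proof. exact: mmapD. Qed.

Lemma pevalZ a c f : peval a (c *: f) = c *: peval a f.
Proof. by rewrite /peval mmapZ /= mulr_algl. Qed.

Lemma peval1 a : peval a 1 = 1.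
Proof. exact: mmap1. Qed.

Lemma pevalM a f g : peval a (f * g) = peval a f * peval a g.
Proof.
suff [-> //] : multiplicative (peval a).
apply: commr_mmap_is_multiplicative => h m m'.
by rewrite /GRing.comm /= mulr_algl mulr_algr.
Qed.

Definition in_center (c : A) : Prop := forall b : A, c * b = b * c.

Definition polynomial_identity f : Prop := forall a, peval a f = 0.

Definition central_polynomial f : Prop := forall a, in_center (peval a f).

Definition proper_central f : Prop :=
  central_polynomial f /\ ~ polynomial_identity f.

(* Nonzero constants are proper central polynomials of every unital algebra,  *)
(* so the existence clause asks for one without constant term.                *)
Definition primeness_property : Prop :=
  (exists f, no_constant_term f /\ proper_central f) /\
  forall (r s : nat) f g,
    in_vars [pred i | (i < r)%N] f ->
    in_vars [pred i | (r <= i < s)%N] g ->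
    proper_central (f * g) -> proper_central f /\ proper_central g.

End Polynomials.

Arguments primeness_property F A : clear implicits.

(* Main.v *)
(* Both algebras are subalgebras of M_m(E).

   Primeness. Let f g be a proper central polynomial and let a, b be tuples of
   matrices; renaming the generators in b, the values P = f(a) and Q = g(b) may
   be assumed to involve disjoint sets of generators. If P_S, Q_T are their
   coefficients at the monomials e_S, e_T, then P_S Q_T is the coefficient of
   P Q at e_S e_T, hence a scalar matrix, and zero if |S| + |T| is odd. Some of
   these products are nonzero, so some P_S and Q_T are invertible, and it follows
   that all monomials of all values of f have the same parity. Conjugating
   by 1 + e_h N, where N is a scalar matrix and e_h a new generator, gives
   N P_S = (-1)^|S| P_S N, and therefore P is central.

   Existence. Formanek's polynomial F(x; y) is linear in each y_i. If x is
   diagonal, F(x; y) is the diagonal matrix of the sums, over the closed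
   Hamiltonian paths based at a vertex, of the weighted products of the
   corresponding entries of the y_i, summed over the rotations of the y_i. In
   M_{k,k}(E) rotating a path changes the product by a sign, so F(x; y) is an
   even scalar times diag(1, -1), and F(x; y) F(x; z) is central. In M_k(E)
   rotating changes the product by a commutator in E, so F(x; y) is a scalar
   matrix up to central entries, and F(x; y) F(x; z) - F(x; z) F(x; y) is
   central. For arbitrary x, put X = D + t (x - D) with D diagonal over F with
   distinct entries: X is conjugate to a diagonal matrix modulo any power of t,
   so the value at X is central as a polynomial in t, and one sets t = 1. *)

Require Import Defs.
From mathcomp Require Import all_boot all_order all_fingroup all_algebra.
From mathcomp Require Import finmap.
From mathcomp.multinomials Require Import monalg.
From mathcomp Require Import zify.

Set Implicit Arguments.
Unset Strict Implicit.
Unset Printing Implicit Defensive.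

Import GRing.Theory.
Local Open Scope ring_scope.

(** * Formanek's polynomial *)

Lemma subr_cancel_pairs (V : zmodType) (p q r u v : V) :
  p + q + (r + u) - (p + r + (q + v)) = u - v.
Proof.
by rewrite [X in X - _]addrACA opprD [LHS]addrACA subrr add0r opprD [LHS]addrACA subrr
    add0r.
Qed.

Section FormanekDef.
Variable m : nat.
Local Notation I := 'I_m.+1.

Definition cyc_perm : 'S_m.+1 := perm (can_inj (@ordSK m.+1)).

Definition formanek_sign (w : ('S_m.+1 * 'S_m.+1) * ('S_m.+1 * 'S_m.+1)) : bool :=
  (w.1.1 (+) w.1.2) (+) (w.2.1 (+) w.2.2).

(* At x = diag(l), the two permutations of w.1 (resp. w.2) contribute the
   squared Vandermonde determinant in the eigenvalues at which y_0, ..., y_m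
   start (resp. end), so that only closed Hamiltonian paths survive.  Squares
   are needed because the eigenvalues do not commute when x has entries in E. *)
Definition formanek1 (B : nzRingType) (x : B) (y : I -> B) : B :=
  \sum_w (-1) ^+ formanek_sign w *
    \prod_(p < m.+1) (x ^+ (w.1.1 p + w.1.2 p) * y p * x ^+ (w.2.1 p + w.2.2 p)).

(** Summing over the rotations of [y] makes every diagonal entry at a diagonal [x] a sum over the
    same closed paths, each entry reading them from its own base point. *)
Definition formanek (B : nzRingType) (x : B) (y : I -> B) : B :=
  \sum_(r < m.+1) formanek1 x (fun p => y ((cyc_perm ^+ r)%g p)).

(* The parameter s is true for M_k(E) and false for M_{k,k}(E). *)
Definition formanek_central (s : bool) (B : nzRingType) (x : B) (y z : I -> B) : B :=
  if s then formanek x y * formanek x z - formanek x z * formanek x y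
  else formanek x y * formanek x z.

(* R can be the graph of a morphism, or conjugation up to a congruence. *)
Lemma formanek_central_rel (B1 B2 : nzRingType) (R : B1 -> B2 -> Prop) s x x' y y' z
    z' :
    R 1 1 -> (forall a a' b b', R a a' -> R b b' -> R (a - b) (a' - b')) ->
    (forall a a' b b', R a a' -> R b b' -> R (a * b) (a' * b')) ->
    R x x' -> (forall p, R (y p) (y' p)) -> (forall p, R (z p) (z' p)) ->
  R (formanek_central s x y z) (formanek_central s x' y' z').
Proof.
move=> R1 RB RM Rx Ry Rz.
have R0 : R 0 0 by rewrite -(subrr 1) -[X in R _ X](subrr 1); apply: RB.
have RN a a' : R a a' -> R (- a) (- a') by rewrite -[- a]sub0r -[- a']sub0r; apply: RB.
have RD a a' b b' : R a a' -> R b b' -> R (a + b) (a' + b').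
  by move=> Ra Rb; rewrite -[b]opprK -[b']opprK; apply: RB => //; apply: RN.
have RX a a' n : R a a' -> R (a ^+ n) (a' ^+ n).
  by move=> Ra; elim: n => [|n IHn]; rewrite ?expr0 // !exprS; apply: RM.
have Rf t t' : (forall p, R (t p) (t' p)) -> R (formanek x t) (formanek x' t').
  move=> Rt; apply: big_ind2 => // r _; apply: big_ind2 => // w _.
  apply: (RM); first by apply: RX; apply: RN.
  by apply: big_ind2 => // p _; apply: (RM); [apply: (RM)|]; rewrite ?Rt //; apply: RX.
by rewrite /formanek_central; case: s; [apply: RB|]; apply: RM; apply: Rf.
Qed.

End FormanekDef.

(** The product is ordered, so the two distinguished factors are taken in the order in which the
    enumeration of [T] meets them. The surrounding [A], [U], [C] serve for every [c'] that differs
    from [c] only there. *)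
Lemma prod_two_factors (R : pzRingType) (T : finType) (p0 q0 : T) : p0 != q0 ->
  exists p q, ((p, q) = (p0, q0) \/ (p, q) = (q0, p0)) /\
    forall c : T -> R, exists A U C, forall c' : T -> R,
      (forall k, k != p -> k != q -> c' k = c k) ->
      \prod_k c' k = A * c' p * U * c' q * C.
Proof.
move=> npq; have: p0 \in index_enum T by rewrite mem_index_enum.
have: q0 \in index_enum T by rewrite mem_index_enum.
have := index_enum_uniq T; move: (index_enum T) => e' ue qe pe.
suff H (p q : T) e1 e2 e3 : e' = e1 ++ p :: e2 ++ q :: e3 ->
    forall c : T -> R, exists A U C, forall c' : T -> R,
      (forall k, k != p -> k != q -> c' k = c k) ->
      \prod_(k <- e') c' k = A * c' p * U * c' q * C.
  case/splitPr: pe (H) ue qe => e1 e2 {}H ue.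
  rewrite mem_cat inE eq_sym (negPf npq) /= => /orP[] /[dup] qe /splitPr.
    case/splitPr: qe H ue => e3 e4 H ue _; exists q0, p0; split; first by right.
    by apply: (H _ _ e3 e4 e2); rewrite -catA.
  case/splitPr: qe H ue => e3 e4 H ue _; exists p0, q0; split; first by left.
  exact: (H _ _ e1 e3 e4).
move=> E c; exists (\prod_(k <- e1) c k), (\prod_(k <- e2) c k), (\prod_(k <- e3) c k).
move=> c' cc'; rewrite E big_cat big_cons big_cat big_cons /= !mulrA.
have /andP[pE qE] : (p \notin e1 ++ e2 ++ e3) && (q \notin e1 ++ e2 ++ e3).
  have : uniq (p :: q :: e1 ++ e2 ++ e3).
    by rewrite -(@perm_uniq _ e') // E; apply/seq.permP => a; rewrite /= !count_cat /=
        !count_cat /=; move: (a p : nat) (a q : nat) => u v; lia.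
  by rewrite /= !inE negb_or => /and3P[/andP[_ ->] -> _].
have Hc s : {subset s <= e1 ++ e2 ++ e3} -> \prod_(k <- s) c' k = \prod_(k <- s) c k.
  move=> sP; rewrite !big_seq; apply: eq_bigr => k /sP kE.
  by apply: cc'; apply: contraTneq kE => ->.
by rewrite !Hc // => k kE; rewrite !mem_cat kE ?orbT.
Qed.

(** * Vanishing of alternating sums at a repeated eigenvalue *)

Section AlternatingPowerSum.
Variable R : nzRingType.
Hypothesis cc : forall a b c : R, (a * b - b * a) * c = c * (a * b - b * a).
Hypothesis t2 : forall a : R, a + a = 0 -> a = 0.

(** Once the smaller power of [l] is taken out on both sides, what remains between them is a
    commutator of [u] with a power of [l], central by [cc]. *)
Lemma alternant_comm (l u : R) a b :
  l * (l ^+ a * u * l ^+ b - l ^+ b * u * l ^+ a) =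
    (l ^+ a * u * l ^+ b - l ^+ b * u * l ^+ a) * l.
Proof.
wlog leab : a b / (a <= b)%N.
  move=> H; have [/H//|/ltnW/H ba] := leqP a b.
  by rewrite -(opprB (l ^+ b * u * l ^+ a)) mulrN mulNr ba.
have -> : l ^+ a * u * l ^+ b - l ^+ b * u * l ^+ a =
    l ^+ a * (u * l ^+ (b - a) - l ^+ (b - a) * u) * l ^+ a.
  rewrite mulrBr mulrBl; congr (_ - _).
    by rewrite -!mulrA -exprD subnK.
  by rewrite !mulrA -exprD subnKC.
by rewrite -cc -[_ * _ * l ^+ a]mulrA -exprD mulrA -cc -!mulrA -exprS -exprSr.
Qed.

(** With [D] the alternant in [a2], [b2], the expression is l^a1 D l^b1 - l^b1 D l^a1, and [D]
    commutes with [l]. One alternation yields only an element commuting with [l]; the second one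
    makes it vanish. *)
Lemma alternant_swap2 (l u : R) a1 a2 b1 b2 :
  l ^+ (a1 + a2) * u * l ^+ (b1 + b2) - l ^+ (b1 + a2) * u * l ^+ (a1 + b2)
  - (l ^+ (a1 + b2) * u * l ^+ (b1 + a2) - l ^+ (b1 + b2) * u * l ^+ (a1 + a2)) = 0.
Proof.
pose D := l ^+ a2 * u * l ^+ b2 - l ^+ b2 * u * l ^+ a2.
have lD n : l ^+ n * D = D * l ^+ n.
  by apply: commr_sym; apply: commrX; apply/esym; exact: alternant_comm.
transitivity (l ^+ a1 * D * l ^+ b1 - l ^+ b1 * D * l ^+ a1).
  rewrite /D !mulrBr !mulrBl !mulrA -!exprD -!mulrA -!exprD.
  rewrite [(b2 + b1)%N]addnC [(a2 + b1)%N]addnC [(b2 + a1)%N]addnC [(a2 + a1)%N]addnC.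
  by rewrite !opprB addrACA [RHS]addrACA [in RHS](addrC (- _)).
by rewrite !lD -!mulrA -!exprD addnC subrr.
Qed.

(** If s p = s q, the transposition of p and q can be applied to either permutation of [w], or to
    both. The four signed terms so obtained add up to the expression of [alternant_swap2] between
    fixed factors, so four times the sum is zero, and [t2] is used twice. *)
Lemma alternating_power_sum0 (m k : nat) (s : 'I_m -> 'I_k) (l : 'I_k -> R) (u v :
    'I_m -> R) :
    ~ injective s ->
  \sum_(w : 'S_m * 'S_m) (-1) ^+ (w.1 (+) w.2)
    * \prod_(p < m) (u p * l (s p) ^+ (w.1 p + w.2 p) * v p) = 0.
Proof.
move=> /injectiveP /injectivePn[p0 [q0 npq0 sE0]].
have [p [q [pqE spl]]] := prod_two_factors R npq0.
have [npq sE] : p != q /\ s p = s q.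
  by case: pqE => -[-> ->]; rewrite // eq_sym.
pose t := tperm p q; pose G (w : 'S_m * 'S_m) := (-1) ^+ (w.1 (+) w.2)
    * \prod_(p < m) (u p * l (s p) ^+ (w.1 p + w.2 p) * v p).
have inv1 : involutive (fun w : 'S_m * 'S_m => ((t * w.1)%g, w.2)).
  by case=> w1 w2; rewrite /= mulgA tperm2 mul1g.
have inv2 : involutive (fun w : 'S_m * 'S_m => (w.1, (t * w.2)%g)).
  by case=> w1 w2; rewrite /= mulgA tperm2 mul1g.
rewrite -/(\sum_w G w); apply: t2; apply: t2.
have E1 : \sum_w G w = \sum_w G ((t * w.1)%g, w.2).
  exact: (reindex_inj (inv_inj inv1)).
have E2 : \sum_w G w = \sum_w G (w.1, (t * w.2)%g).
  exact: (reindex_inj (inv_inj inv2)).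
have E3 : \sum_w G w = \sum_w G ((t * w.1)%g, (t * w.2)%g).
  by rewrite E1 (reindex_inj (inv_inj inv2)).
rewrite {2}E1 {2}E2 {2}E3 -!big_split /=; apply: big1 => -[w1 w2] _ /=.
rewrite /G /= !odd_permM odd_tperm npq !addTb !(addNb, addbN) negbK !signrN.
have [A [U [C HP]]] := spl (fun k => u k * l (s k) ^+ (w1 k + w2 k) * v k).
have HE (a b : 'S_m) : {in predC (pred2 p q), a =1 w1} ->
    {in predC (pred2 p q), b =1 w2} ->
  \prod_k (u k * l (s k) ^+ (a k + b k) * v k) = A * (u p * l (s q) ^+ (a p + b p) * v
      p)
     * U * (u q * l (s q) ^+ (a q + b q) * v q) * C.
  move=> aw bw; rewrite -{1}sE.
  apply: (HP (fun k => u k * l (s k) ^+ (a k + b k) * v k)) => j jp jq.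
  by rewrite aw ?bw // !inE negb_or jp.
have tw (a : 'S_m) : {in predC (pred2 p q), (t * a)%g =1 a}.
  by move=> j; rewrite !inE negb_or => /andP[jp jq]; rewrite permM tpermD // eq_sym.
rewrite 4?HE // !permM tpermL tpermR.
have := alternant_swap2 (l (s q)) (v p * U * u q) (w1 p) (w2 p) (w1 q) (w2 q).
move/(congr1 (fun x => (-1) ^+ (w1 (+) w2) * (A * u p * x * (v q * C)))).
rewrite mulr0 mul0r mulr0 => <-.
rewrite !mulrBr !mulrBl !mulrBr !mulrA !opprB !mulNr.
by rewrite -!addrA; congr (_ + (_ + _)); rewrite addrC.
Qed.

End AlternatingPowerSum.

(** * Values at diagonal matrices *)

Section Emx.
Variables (R : nzRingType) (n : nat).
Local Notation I := 'I_n.+1.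

Definition elem_mx (r : R) (i j : I) : 'M[R]_n.+1 :=
  \matrix_(a, b) (r *+ ((a == i) && (b == j))).

Lemma elem_mx_sum (K : finType) (r : K -> R) i j :
  elem_mx (\sum_k r k) i j = \sum_k elem_mx (r k) i j.
Proof.
apply/matrixP => a b; rewrite summxE mxE -sumrMnl.
by apply: eq_bigr => k _; rewrite mxE.
Qed.

Lemma elem_mx0 i j : elem_mx 0 i j = 0.
Proof. by apply/matrixP => a b; rewrite !mxE mul0rn. Qed.

Lemma elem_mx_sign (b : bool) r i j : (-1) ^+ b * elem_mx r i j = elem_mx ((-1) ^+ b *
    r) i j.
Proof.
case: b; rewrite ?expr0 ?mul1r // expr1 !mulN1r.
by apply/matrixP => a c; rewrite !mxE mulNrn.
Qed.

Lemma mul_elem_mx r i j t k l :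
  elem_mx r i j * elem_mx t k l = if j == k then elem_mx (r * t) i l else 0.
Proof.
apply/matrixP => a b; rewrite !mxE (bigD1 j) //= big1 ?addr0.
  rewrite !mxE eqxx andbT; case: (eqVneq j k) => [_|_] /=; last by rewrite mulr0 mxE.
  by rewrite mxE mulrnAl mulrnAr -mulrnA; congr (_ *+ _); case: (a == i) (b == l) =>
      [] [].
by move=> c jc; rewrite !mxE (negPf jc) andbF mul0r.
Qed.

Lemma matrix_elem_mx (M : 'M[R]_n.+1) : M = \sum_(q : I * I) elem_mx (M q.1 q.2) q.1
    q.2.
Proof.
apply/matrixP => a b; rewrite summxE (bigD1 (a, b)) //= mxE !eqxx big1 ?addr0 //.
case=> i j; rewrite xpair_eqE negb_and mxE /= => ij.
by rewrite [a == i]eq_sym [b == j]eq_sym; case: eqP ij => //= _ /negPf->.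
Qed.

Lemma prod_elem_mx k (r : nat -> R) (s t : nat -> I) :
  \prod_(p < k.+1) elem_mx (r p) (s p) (t p) =
    if all (fun p => t p == s p.+1) (iota 0 k)
    then elem_mx (\prod_(p < k.+1) r p) (s 0) (t k) else 0.
Proof.
elim: k => [|k IHk]; first by rewrite !big_ord1.
rewrite big_ord_recr -[X in iota 0 X]addn1 IHk iotaD all_cat /= add0n andbT.
case: (all _ _); last by rewrite mul0r.
by rewrite mul_elem_mx [in RHS]big_ord_recr.
Qed.

End Emx.

Lemma ordS_inord n k : (k < n)%N -> ordS (inord k : 'I_n.+1) = inord k.+1.
Proof.
move=> kn; apply: val_inj; rewrite /= !inordK //; last exact: ltnW.
by rewrite modn_small.
Qed.

Lemma ordS_max n : ordS (@ord_max n) = ord0.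
Proof. by apply: val_inj; rewrite /= modnn. Qed.

Lemma cyc_permX n k : (k < n.+1)%N -> (cyc_perm n ^+ k)%g ord0 = inord k.
Proof.
elim: k => [_|k IHk kn]; first by rewrite expg0 perm1; apply: val_inj; rewrite /=
    inordK.
by rewrite expgSr permM IHk ?permE ?ordS_inord // ltnW.
Qed.

Lemma cyc_permX_id n : (cyc_perm n ^+ n.+1)%g ord0 = ord0.
Proof.
rewrite expgSr permM cyc_permX // permE -[RHS]ordS_max; congr ordS.
by apply: val_inj; rewrite /= inordK.
Qed.

Lemma cyc_permX_ord0 n (p : 'I_n.+1) : p = (cyc_perm n ^+ p)%g ord0.
Proof. by rewrite cyc_permX ?inord_val. Qed.

Section Diagonal.
Variables (R : nzRingType) (m : nat).
Hypothesis cc : forall a b c : R, (a * b - b * a) * c = c * (a * b - b * a).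
Hypothesis t2 : forall a : R, a + a = 0 -> a = 0.
Local Notation I := 'I_m.+1.
Variable l : I -> R.
Implicit Types (y z : I -> 'M[R]_m.+1) (s : 'S_m.+1).

Let D : 'M[R]_m.+1 := diag_mx (\row_i l i).

Lemma diagX a i j : (D ^+ a) i j = l i ^+ a *+ (i == j).
Proof.
elim: a j => [|a IHa] j; first by rewrite !expr0 mxE.
rewrite exprSr mxE (bigD1 i) //= big1 ?addr0.
  by rewrite IHa eqxx !mxE mulrnAr exprSr.
by move=> k ki; rewrite IHa eq_sym (negPf ki) mul0r.
Qed.

Lemma diag_sandwich a b (M : 'M[R]_m.+1) i j :
  (D ^+ a * M * D ^+ b) i j = l i ^+ a * M i j * l j ^+ b.
Proof.
rewrite mxE (bigD1 j) //= big1 ?addr0 => [|k kj].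
  rewrite diagX eqxx mxE (bigD1 i) //= big1 ?addr0 ?diagX ?eqxx // => k ki.
  by rewrite diagX eq_sym (negPf ki) mul0r.
by rewrite diagX (negPf kj) mulr0.
Qed.

(** The contribution of the edge [f p], from [(f p).1] to [(f p).2], at place [p]; consecutive edges
    of [f] are not yet required to meet. *)
Let fact y (f : I -> I * I) (w : ('S_m.+1 * 'S_m.+1) * ('S_m.+1 * 'S_m.+1)) p : R :=
  l (f p).1 ^+ (w.1.1 p + w.1.2 p) * y p (f p).1 (f p).2
    * l (f p).2 ^+ (w.2.1 p + w.2.2 p).

Let wt y f := \sum_w (-1) ^+ formanek_sign w * \prod_(p < m.+1) fact y f w p.

(** For repeated starts fix [w.2] and sum over [w.1], for repeated ends the reverse: the inner sum
    is an alternating power sum with a repeated eigenvalue. *)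
Let wt0 y f : ~ injective (fun p => (f p).1) \/ ~ injective (fun p => (f p).2) ->
  wt y f = 0.
Proof.
case=> ninj; rewrite /wt.
  rewrite -(pair_bigA _ (fun w1 w2 => (-1) ^+ formanek_sign (w1, w2) *
     \prod_(p < m.+1) fact y f (w1, w2) p)) exchange_big big1 //= => w2 _.
  have := alternating_power_sum0 cc t2 l (fun=> 1) (fun p => y p (f p).1 (f p).2
    * l (f p).2 ^+ (w2.1 p + w2.2 p)) ninj.
  move/(congr1 (fun a => (-1) ^+ (w2.1 (+) w2.2) * a)); rewrite mulr0 mulr_sumr => E;
      rewrite -[RHS]E.
  apply: eq_bigr => w1 _.
  rewrite mulrA -signr_addb addbC; congr (_ * _); apply: eq_bigr => p _.
  by rewrite mul1r mulrA.
rewrite -(pair_bigA _ (fun w1 w2 => (-1) ^+ formanek_sign (w1, w2) *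
     \prod_(p < m.+1) fact y f (w1, w2) p)) big1 //= => w1 _.
have := alternating_power_sum0 cc t2 l (fun p => l (f p).1 ^+ (w1.1 p + w1.2 p) * y p
    (f p).1 (f p).2)
   (fun=> 1) ninj.
move/(congr1 (fun a => (-1) ^+ (w1.1 (+) w1.2) * a)); rewrite mulr0 mulr_sumr => E;
    rewrite -[RHS]E.
apply: eq_bigr => w2 _.
rewrite mulrA -signr_addb; congr (_ * _); apply: eq_bigr => p _.
by rewrite mulr1.
Qed.

(** The weight of the closed Hamiltonian path s 0, s 1, ..., s m, s 0, the edge at place [p]
    carrying an entry of [y p]. *)
Definition cyc_wt y s : R := \sum_w (-1) ^+ formanek_sign w *
  \prod_(p < m.+1) (l (s p) ^+ (w.1.1 p + w.1.2 p) * y p (s p) (s (cyc_perm m p))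
    * l (s (cyc_perm m p)) ^+ (w.2.1 p + w.2.2 p)).

(** Expanding every factor in matrix units gives a sum over sequences [f] of edges. A nonzero term
    needs consecutive edges to meet ([ok]) and neither starts nor ends to repeat ([wt0]); such an
    [f] is a closed Hamiltonian path. *)
Lemma formanek1_diag y :
  formanek1 D y = \sum_s elem_mx (cyc_wt y s) (s ord0) (s ord0).
Proof.
pose f0 (f : I -> I * I) k := f (inord k).
pose ok (f : I -> I * I) := all (fun p => (f0 f p).2 == (f0 f p.+1).1) (iota 0 m).
pose G (f : {ffun I -> I * I}) : 'M[R]_m.+1 :=
  if ok f then elem_mx (wt y f) (f ord0).1 (f ord_max).2 else 0.
have -> : formanek1 D y = \sum_f G f.
  transitivity (\sum_w \sum_(f : {ffun I -> I * I}) (-1) ^+ formanek_sign w *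
     (if ok f then elem_mx (\prod_(p < m.+1) fact y f w p) (f ord0).1 (f ord_max).2
      else 0) : 'M[R]_m.+1).
    apply: eq_bigr => w _; rewrite -mulr_sumr; congr (_ * _).
    transitivity (\prod_(p < m.+1) \sum_(q : I * I)
      elem_mx (l q.1 ^+ (w.1.1 p + w.1.2 p) * y p q.1 q.2
            * l q.2 ^+ (w.2.1 p + w.2.2 p)) q.1 q.2).
      apply: eq_bigr => p _; rewrite [LHS]matrix_elem_mx; apply: eq_bigr => q _.
      by rewrite diag_sandwich.
    rewrite bigA_distr_bigA; apply: eq_bigr => f _.
    have := prod_elem_mx m (fun k => fact y f w (inord k)) (fun k => (f0 f k).1)
       (fun k => (f0 f k).2).
    rewrite -/(ok f) /f0 => E; transitivity (\prod_(p < m.+1)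
      elem_mx (fact y f w (inord p)) (f (inord p)).1 (f (inord p)).2).
      by apply: eq_bigr => p _; rewrite inord_val.
    rewrite E; case: (ok f) => //; congr elem_mx.
    - by apply: eq_bigr => p _; rewrite inord_val.
    - by congr (f _).1; apply: val_inj; rewrite /= inordK.
    - by congr (f _).2; apply: val_inj; rewrite /= inordK.
  rewrite exchange_big; apply: eq_bigr => f _; rewrite /G.
  case: (ok f); last by apply: big1 => w _; rewrite mulr0.
  by rewrite /wt elem_mx_sum; apply: eq_bigr => w _; rewrite elem_mx_sign.
pose emb s : {ffun I -> I * I} := [ffun p => (s p, s (cyc_perm m p))].
have emb_inj : injective emb.
  by move=> s t /ffunP E; apply/permP => p; move: (E p); rewrite !ffunE => -[].
have Gemb s : G (emb s) = elem_mx (cyc_wt y s) (s ord0) (s ord0).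
  rewrite /G; have -> : ok (emb s).
    apply/allP => k; rewrite mem_iota /= add0n => km.
    by rewrite /f0 !ffunE /= permE ordS_inord.
  rewrite !ffunE /= [cyc_perm m _]permE ordS_max; congr elem_mx.
  by apply: eq_bigr => w _; congr (_ * _); apply: eq_bigr => p _; rewrite /fact ffunE.
rewrite (bigID (mem [set emb s | s : 'S_m.+1])) /= [X in _ + X]big1 ?addr0.
  by rewrite big_imset /=; [apply: eq_bigr => s _; apply: Gemb|move=> s t _ _; apply:
      emb_inj].
move=> f /imsetP nf; rewrite /G; case: ifP => // /allP okf.
have [sP|/injectiveP ns] := boolP (injectiveb (fun p => (f p).1)); last first.
  by rewrite wt0 ?elem_mx0 //; left.
have [tP|/injectiveP nt] := boolP (injectiveb (fun p => (f p).2)); last first.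
  by rewrite wt0 ?elem_mx0 //; right.
case: nf; exists (perm (injectiveP _ sP)) => //; apply/ffunP => p; rewrite ffunE !permE.
have E k : (k < m)%N -> (f (inord k)).2 = (f (inord k.+1)).1.
  by move=> km; apply/eqP/okf; rewrite mem_iota.
rewrite [LHS]surjective_pairing; congr (_, _).
have [pm|] := ltnP p m.
  by rewrite -[in LHS](inord_val p) E // -ordS_inord // inord_val.
rewrite leq_eqVlt ltnNge -ltnS ltn_ord orbF => /eqP mp.
have -> : p = ord_max by apply: val_inj.
rewrite ordS_max.
(* The last edge ends where some edge [q] starts. If [q] were not the first edge, its predecessor
   would end there too, against the injectivity of the ends. *)
have [h _ hK] := injF_bij (injectiveP _ sP).
have := hK (f ord_max).2; set q := h _ => /= qE; rewrite -qE.
have [->//|q0] := eqVneq q ord0.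
have qS : (0 < q)%N by rewrite lt0n.
have qm : (q.-1 < m)%N by rewrite -ltnS prednK.
move: (E _ qm); rewrite prednK // inord_val qE => /(injectiveP _ tP) /(congr1 val) /=.
by rewrite inordK; lia.
Qed.


Let loop y s (w : ('S_m.+1 * 'S_m.+1) * ('S_m.+1 * 'S_m.+1)) k : R := let p :=
    (cyc_perm m ^+ k)%g ord0 in
  l (s p) ^+ (w.1.1 p + w.1.2 p) * y p (s p) (s (cyc_perm m p))
    * l (s (cyc_perm m p)) ^+ (w.2.1 p + w.2.2 p).

Let loop_period y s w k : loop y s w (k + m.+1) = loop y s w k.
Proof. by rewrite /loop addnC expgD permM cyc_permX_id. Qed.

Let wt_rot y s r := cyc_wt (fun p => y ((cyc_perm m ^+ r)%g p)) (cyc_perm m ^+ r * s)%g.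

(** The rotation is absorbed into the four exponent permutations: its sign enters four times and
    cancels. *)
Let rot_wt y s r : wt_rot y s r =
  \sum_w (-1) ^+ formanek_sign w * \prod_(k < m.+1) loop y s w (r + k).
Proof.
pose h (w : ('S_m.+1 * 'S_m.+1) * ('S_m.+1 * 'S_m.+1)) :=
  (((cyc_perm m ^+ r * w.1.1)%g, (cyc_perm m ^+ r * w.1.2)%g),
   ((cyc_perm m ^+ r * w.2.1)%g, (cyc_perm m ^+ r * w.2.2)%g)).
have h_inj : injective h.
  by move=> [[a b] [c d]] [[a' b'] [c' d']] [] /mulgI-> /mulgI-> /mulgI-> /mulgI->.
rewrite /wt_rot /cyc_wt (reindex_inj h_inj); apply: eq_bigr => w _.
have -> : formanek_sign (h w) = formanek_sign w.
  rewrite /formanek_sign /h /= !odd_permM.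
  by case: (odd_perm _) (odd_perm w.1.1) (odd_perm w.1.2) (odd_perm w.2.1)
           (odd_perm w.2.2) => [] [] [] [] [].
congr (_ * _); apply: eq_bigr => p _.
have cycC q : (cyc_perm m ^+ r)%g (cyc_perm m q) = cyc_perm m ((cyc_perm m ^+ r)%g q).
  by rewrite -!permM -expgS -expgSr.
by rewrite /loop [(r + p)%N]addnC expgD [in RHS]permM -cyc_permX_ord0 /h /= !permM cycC.
Qed.

Local Notation inv_at s i := (((s^-1)%g : {perm I}) i).

(** After rotation by [r] the path [s] is based at the vertex s r, so it contributes to entry [i]
    for exactly one [r], the position of [i] on the path. *)
Lemma formanek_diagE y i j : formanek D y i j =
  (\sum_s wt_rot y s (inv_at s i)) *+ (i == j).
Proof.
rewrite /formanek summxE.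
transitivity (\sum_(r < m.+1) \sum_s
  wt_rot y s r *+ ((s (inord r) == i) && (i == j))).
  apply: eq_bigr => r _; rewrite formanek1_diag summxE.
  rewrite (reindex_inj (mulgI (cyc_perm m ^+ r)%g)) /=; apply: eq_bigr => s _.
  rewrite mxE permM (cyc_permX (ltn_ord r)) [i == s _]eq_sym; congr (_ *+ _).
  by case: (s _ =P i) => //= <-; rewrite eq_sym.
rewrite exchange_big -sumrMnl /=; apply: eq_bigr => s _.
rewrite (bigD1 (inv_at s i)) //= inord_val permKV eqxx big1 ?addr0 // => r ri.
rewrite inord_val; case: eqP => // E; case/eqP: ri.
by rewrite -E permK.
Qed.

Lemma formanek_offdiag y i j : i != j -> formanek D y i j = 0.
Proof. by move=> ij; rewrite formanek_diagE (negPf ij). Qed.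

Let loop_rot y s w r (X := \prod_(k < m) loop y s w (r.+1 + k)) :
  \prod_(k < m.+1) loop y s w (r + k) = loop y s w r * X /\
  \prod_(k < m.+1) loop y s w (r.+1 + k) = X * loop y s w r.
Proof.
split; [rewrite big_ord_recl | rewrite big_ord_recr] => /=.
  by rewrite addn0; congr (_ * _); apply: eq_bigr => k _; rewrite addSnnS.
by rewrite -[loop y s w r]loop_period addSnnS.
Qed.

(* Rotating a closed path changes its weight by a commutator, which is central. *)
Lemma formanek_diag_central y : exists K : R, forall j c : _,
  (formanek D y j j - K) * c = c * (formanek D y j j - K).
Proof.
exists (\sum_s wt_rot y s 0) => j c.
rewrite formanek_diagE eqxx mulr1n -sumrB mulr_suml mulr_sumr; apply: eq_bigr => s _.
elim: (nat_of_ord (inv_at s j)) => [|r IHr]; first by rewrite subrr mul0r mulr0.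
have -> (a : R) : a - wt_rot y s 0 = (a - wt_rot y s r) + (wt_rot y s r - wt_rot y s 0).
  by rewrite addrA subrK.
rewrite mulrDl mulrDr IHr; congr (_ + _).
rewrite !rot_wt -sumrB mulr_suml mulr_sumr; apply: eq_bigr => w _.
have [-> ->] := loop_rot y s w r.
by rewrite -mulrBr -mulrA cc; case: (formanek_sign w); rewrite ?expr0 ?mul1r // expr1
    !mulN1r mulrN.
Qed.

(** * Paths with entries of prescribed parity *)

Section Super.
Variables (T : bool -> R -> Prop) (par : I -> bool).
Hypothesis T1 : T false 1.
Hypothesis TB : forall a u v, T a u -> T a v -> T a (u - v).
Hypothesis TM : forall a b u v, T a u -> T b v -> T (a (+) b) (u * v).
Hypothesis TC : forall a b u v, T a u -> T b v -> u * v = (-1) ^+ (a && b) * (v * u).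
Hypothesis Tl : forall i, T false (l i).

(* Moving an edge from the start of a closed path to its end costs the sign
   (-1) ^ (parity of the edge), since the path is even as a whole. *)
Lemma formanek_diag_super y :
    (forall p i j, T (par i (+) par j) (y p i j)) ->
  exists2 K : R, T false K & forall j, formanek D y j j = (-1) ^+ par j * K.
Proof.
move=> Ty.
have T0 : T false 0 by rewrite -(subrr 1); apply: TB.
have TN a x : T a x -> T a (- x).
  by move=> Tx; have := TB (TB Tx Tx) Tx; rewrite subrr sub0r.
have TX x n : T false x -> T false (x ^+ n).
  by move=> Tx; elim: n => [|n IHn] //; rewrite exprS; apply: (TM Tx).
(* The parity of the k-th vertex of the path; an edge, and any stretch of the path, has the sum of
   the parities of its two ends. *)
pose g (s : 'S_m.+1) k := par (s ((cyc_perm m ^+ k)%g ord0)).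
have Tloop s w k : T (g s k (+) g s k.+1) (loop y s w k).
  rewrite /loop /=; set p := (cyc_perm m ^+ k)%g _; set a := _ ^+ _; set b := _ ^+ (_
      + _).
  have -> : g s k.+1 = par (s (cyc_perm m p)) by rewrite /g expgSr permM.
  have Ta : T false a by apply: TX. have Tb : T false b by apply: TX.
  by have := TM (TM Ta (Ty p (s p) (s (cyc_perm m p)))) Tb; rewrite addbF.
have Tprod s w r n : T (g s r (+) g s (r + n)%N) (\prod_(k < n) loop y s w (r + k)).
  elim: n => [|n IHn]; first by rewrite big_ord0 addn0 addbb.
  rewrite big_ord_recr /= addnS -[g s r](addbK (g s (r + n)%N)) -addbA.
  exact: TM.
have g_period s k : g s (k + m.+1)%N = g s k by rewrite /g addnC expgD permM
    cyc_permX_id.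
(* The product of (-1)^(g s r) and [wt_rot y s r] does not depend on the base point [r]; its value
   at r = 0 is taken. *)
exists (\sum_s (-1) ^+ g s 0 * wt_rot y s 0) => [|j].
  have TD a b : T false a -> T false b -> T false (a + b).
    by move=> Ta Tb; rewrite -[b]opprK; apply: TB => //; apply: TN.
  have Tsg (b : bool) a : T false a -> T false ((-1) ^+ b * a).
    by case: b => ?; rewrite ?expr0 ?mul1r // expr1 mulN1r; apply: TN.
  apply: big_ind => [||s _]; [by []|by []|refine (Tsg _ _ _); rewrite rot_wt].
  apply: big_ind => [||w _]; [by []|by []|refine (Tsg _ _ _)].
  by have := Tprod s w 0 m.+1; rewrite g_period addbb.
rewrite formanek_diagE eqxx mulr1n mulr_sumr; apply: eq_bigr => s _.
rewrite mulrA -signr_addb.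
have -> : par j = g s (inv_at s j) by rewrite /g -cyc_permX_ord0 permKV.
elim: (nat_of_ord (inv_at s j)) => [|r IHr]; first by rewrite addbb mul1r.
transitivity ((-1) ^+ (g s r (+) g s r.+1) * wt_rot y s r); last first.
  rewrite IHr mulrA -signr_addb; congr ((-1) ^+ (nat_of_bool _) * _).
  by case: (g s r) (g s r.+1) (g s 0) => [] [] [].
rewrite !rot_wt mulr_sumr; apply: eq_bigr => w _.
have [-> ->] := loop_rot y s w r.
have TX' := Tprod s w r.+1 m; rewrite addSnnS g_period in TX'.
rewrite (TC TX' (Tloop s w r)) [g s r.+1 (+) _]addbC andbb.
by case: (_ (+) _); rewrite ?expr0 ?mul1r // expr1 !mulN1r mulrN.
Qed.

Lemma formanek_central_diag_super y z :
    (forall p i j, T (par i (+) par j) (y p i j)) ->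
    (forall p i j, T (par i (+) par j) (z p i j)) ->
  exists2 K : R, T false K & formanek_central false D y z = K%:M.
Proof.
move=> /formanek_diag_super[K TK KE] /formanek_diag_super[L TL LE].
exists (K * L); first exact: (TM TK TL).
apply/matrixP => i j; rewrite /formanek_central !mxE (bigD1 i) //= big1 ?addr0 => [|k
    ki].
  rewrite KE; have [->|ij] := eqVneq i j; last by rewrite [X in _ * X]formanek_diagE
      (negPf ij) mulr0.
  by rewrite LE -mulrA [K * _]mulrA; case: (par j); rewrite ?(mul1r, mulr1) // !mulN1r
      mulrN1 mulNr opprK.
by rewrite [X in X * _]formanek_diagE eq_sym (negPf ki) mul0r.
Qed.

End Super.

(** The diagonal entries of [formanek D y] and [formanek D z] are K + a and L + b with a, b central,
    so every diagonal entry of their commutator is K L - L K. *)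
Lemma formanek_central_diag_comm y z :
  exists2 K : R, (forall c, K * c = c * K) & formanek_central true D y z = K%:M.
Proof.
have [K KE] := formanek_diag_central y; have [L LE] := formanek_diag_central z.
exists (K * L - L * K); first by move=> c; apply: cc.
have FM (u v : I -> 'M[R]_m.+1) i j : (formanek D u * formanek D v) i j =
    (formanek D u i i * formanek D v i i) *+ (i == j).
  rewrite mxE (bigD1 i) //= big1 ?addr0 => [|k ki]; last first.
    by rewrite [X in X * _]formanek_diagE eq_sym (negPf ki) mul0r.
  by rewrite [formanek D v i j]formanek_diagE [formanek D v i i]formanek_diagE eqxx
      mulrnAr.
apply/matrixP => i j; rewrite /formanek_central [LHS]mxE [X in _ + X]mxE !FM mxE
    -mulrnBl.
congr (_ *+ _); rewrite -[formanek D y i i](subrK K) -[formanek D z i i](subrK L).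
move: (formanek D y i i - K) (KE i) => a aC; move: (formanek D z i i - L) (LE i) => b
    bC.
rewrite !mulrDl !mulrDr (aC b) (aC L) -(bC K).
exact: subr_cancel_pairs.
Qed.

End Diagonal.

(** * A nonzero value *)

Section Witness.
Variables (F : fieldType) (R : algType F) (m : nat).
Hypothesis cc : forall a b c : R, (a * b - b * a) * c = c * (a * b - b * a).
Hypothesis t2 : forall a : R, a + a = 0 -> a = 0.
Local Notation I := 'I_m.+1.
Variable d : I -> F.
Hypothesis d_inj : injective d.

(** The Leibniz expansion of the Vandermonde determinant of the points [a]. *)
Let V (a : I -> F) : F := \sum_(s : 'S_m.+1) (-1) ^+ s * \prod_p a p ^+ s p.

Let V_neq0 a : injective a -> V a != 0.
Proof.
move=> a_inj; have -> : V a = \det (Vandermonde m.+1 (\row_i a i))^T.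
  by apply: eq_bigr => s _; congr (_ * _); apply: eq_bigr => p _; rewrite !mxE.
rewrite det_tr det_Vandermonde; apply/prodf_neq0 => i _; apply/prodf_neq0 => j ij.
by rewrite !mxE subr_eq0 (inj_eq a_inj); apply: contraTneq ij => ->; rewrite ltnn.
Qed.

Let W : F := \sum_(w : ('S_m.+1 * 'S_m.+1) * ('S_m.+1 * 'S_m.+1)) (-1) ^+
    formanek_sign w *
  \prod_p (d p ^+ (w.1.1 p + w.1.2 p) * d (cyc_perm m p) ^+ (w.2.1 p + w.2.2 p)).

(** The sums over the four permutations separate: [W] is the product of the squared Vandermonde
    determinants at the starts [d p] and at the ends [d (cyc_perm m p)]. *)
Let W_neq0 : W != 0.
Proof.
have V2 a : \sum_(w : 'S_m.+1 * 'S_m.+1) (-1) ^+ (w.1 (+) w.2) *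
    \prod_p a p ^+ (w.1 p + w.2 p) = V a * V a.
  rewrite -(pair_bigA _ (fun s t : 'S_m.+1 => (-1) ^+ (s (+) t) * \prod_p a p ^+ (s p
      + t p))) /=.
  rewrite mulr_suml; apply: eq_bigr => s _; rewrite mulr_sumr; apply: eq_bigr => t _.
  rewrite signr_addb mulrACA -big_split /=; congr (_ * _).
  by apply: eq_bigr => p _; rewrite exprD.
have -> : W = (V d * V d) * (V (d \o cyc_perm m) * V (d \o cyc_perm m)).
  rewrite -!V2 mulr_suml /W.
  rewrite -(pair_bigA _ (fun s t : 'S_m.+1 * 'S_m.+1 => (-1) ^+ formanek_sign (s, t) *
    \prod_p (d p ^+ (s.1 p + s.2 p) * d (cyc_perm m p) ^+ (t.1 p + t.2 p)))) /=.
  apply: eq_bigr => s _; rewrite mulr_sumr; apply: eq_bigr => t _.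
  by rewrite /formanek_sign signr_addb mulrACA big_split.
by rewrite !mulf_neq0 ?V_neq0 //; apply: inj_comp => //; apply: perm_inj.
Qed.

(** Supporting each matrix on the single edge from p to its successor leaves only the cycle 0, 1,
    ..., m, and the entry at [ord0] selects its trivial rotation. [W] collects the eigenvalue
    factors of that path. *)
Lemma formanek_cycle : exists2 W : F, W != 0 & forall g : I -> R,
  formanek (diag_mx (\row_i (d i)%:A)) (fun p => elem_mx (g p) p (cyc_perm m p)) ord0
      ord0
    = W *: \prod_p g p.
Proof.
exists W => // g; pose y p : 'M[R]_m.+1 := elem_mx (g p) p (cyc_perm m p).
rewrite -[LHS]/(formanek (diag_mx (\row_i (d i)%:A)) y ord0 ord0) /formanek summxE.
have prod0 (f : I -> R) p : f p = 0 -> \prod_q f q = 0.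
  move=> fp; have: p \in index_enum (ordinal m.+1) by rewrite mem_index_enum.
  by case/splitPr => e1 e2; rewrite big_cat big_cons fp /= mul0r mulr0.
have y0 (r : I) (s : 'S_m.+1) : (cyc_perm m ^+ r)%g != s ->
    cyc_wt (fun i => (d i)%:A) (fun p => y ((cyc_perm m ^+ r)%g p)) s = 0.
  move=> rs; apply: big1 => w _.
  have [p ps] : exists p, (cyc_perm m ^+ r)%g p != s p.
    by apply/existsP; apply: contraNT rs; rewrite negb_exists => /forallP rs;
       apply/eqP/permP => p; apply/eqP/negPn/rs.
  rewrite (prod0 _ p) ?mulr0 //.
  by rewrite mxE eq_sym (negPf ps) mulr0 mul0r.
rewrite (bigD1 ord0) //= (formanek1_diag cc t2) summxE (bigD1 1%g) //=.
rewrite [X in _ + X]big1 ?addr0 => [|r r0]; last first.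
  rewrite (formanek1_diag cc t2) summxE big1 // => s _; rewrite mxE.
  have [E|ne] := eqVneq (cyc_perm m ^+ r)%g s; last by rewrite y0 // mul0rn.
  rewrite -E -cyc_permX_ord0 eq_sym (negPf r0).
  by rewrite mulr0n.
rewrite [X in _ + X]big1 ?addr0 => [|s s1]; last first.
  by rewrite (y0 ord0) ?elem_mx0 ?mxE ?mul0rn // expg0 eq_sym.
rewrite mxE !perm1 eqxx mulr1n /cyc_wt /W scaler_suml; apply: eq_bigr => w _.
rewrite -scalerA -scaler_prod.
have -> (b : bool) (a : R) : ((-1) ^+ b : F) *: a = (-1) ^+ b * a.
  by case: b; rewrite ?expr0 ?scale1r ?mul1r // expr1 scaleN1r mulN1r.
congr (_ * _); apply: eq_bigr => p _.
rewrite !perm1 /y mxE !eqxx mulr1n -!(rmorphXn (in_alg R)) /=.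
by rewrite mulr_algl mulr_algr scalerA mulrC.
Qed.

End Witness.

(** * Commutation rules in the Grassmann algebra *)

Section PolyCenter.
Variable R : nzRingType.

Lemma poly_central (p q : {poly R}) :
  (forall i c, p`_i * c = c * p`_i) -> p * q = q * p.
Proof.
move=> pC; apply/polyP => k; rewrite coefM coefMr.
by apply: eq_bigr => i _; apply: pC.
Qed.

Lemma poly_comm_central :
  (forall a b c : R, (a * b - b * a) * c = c * (a * b - b * a)) ->
  forall p q r : {poly R}, (p * q - q * p) * r = r * (p * q - q * p).
Proof.
move=> cc p q r; apply: poly_central => k c.
rewrite coefB coefM coefMr -sumrB mulr_suml mulr_sumr.
by apply: eq_bigr => i _; apply: cc.
Qed.

Lemma poly_torsion2 : (forall a : R, a + a = 0 -> a = 0) ->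
  forall p : {poly R}, p + p = 0 -> p = 0.
Proof.
move=> t2 p /polyP pp; apply/polyP => i; rewrite coef0; apply: t2.
by rewrite -coefD pp coef0.
Qed.

End PolyCenter.

Section Grassmann.
Variable F : fieldType.
Local Notation E := (grassmann F).
Implicit Types (x y z : E) (S T U : {fset nat}).

(** For disjoint sets a pair (s, t) has s distinct from t, so it is counted in exactly one of the
    two sums. *)
Lemma gr_invC S T : [disjoint S & T]%fset ->
  (gr_inv S T + gr_inv T S = #|` S| * #|` T|)%N.
Proof.
move=> /fdisjointP dST; rewrite /gr_inv [X in (_ + X)%N]exchange_big -big_split /=.
transitivity (\sum_(s <- S) #|` T|)%N; last first.
  by rewrite big_const_seq count_predT iter_addn_0 mulnC.
rewrite !big_seq; apply: eq_bigr => s sS; rewrite -big_split /= big_seq.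
transitivity (\sum_(t <- T) 1)%N; last by rewrite sum1_size.
rewrite [RHS]big_seq; apply: eq_bigr => t tT.
have: s != t by apply: contraTneq tT => <-; apply: dST.
by case: ltngtP.
Qed.

Lemma gr_signC S T :
  gr_sign F S T = (-1) ^+ (odd #|` S| && odd #|` T|) * gr_sign F T S.
Proof.
rewrite /gr_sign fdisjoint_sym; case: ifP => [dTS|_]; last by rewrite mulr0.
have dST : [disjoint S & T]%fset by rewrite fdisjoint_sym.
rewrite -oddM signr_odd -(gr_invC dST) exprD -mulrA -exprD addnn -muln2 mulnC.
by rewrite exprM sqrrN expr1n expr1n mulr1.
Qed.

Lemma mcoeffM (d1 d2 : {fset {fset nat}}) x y U :
  (msupp x `<=` d1)%fset -> (msupp y `<=` d2)%fset ->
  (x * y)@_U = \sum_(S <- d1) \sum_(T <- d2)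
     x@_S * y@_T * gr_sign F S T *+ ((S `|` T)%fset == U).
Proof.
move=> l1 l2; rewrite -[x * y]/(gr_mul x y) (gr_mulEw l1 l2) raddf_sum /=.
apply: eq_bigr => S _; rewrite raddf_sum /=.
by apply: eq_bigr => T _; rewrite mcoeffU.
Qed.

Lemma gr_homogC a b x y : x \in gr_homog F a -> y \in gr_homog F b ->
  x * y = (-1) ^+ (a && b) * (y * x).
Proof.
move=> /allP xa /allP yb.
have sE (c : bool) z : (-1) ^+ c * z = (-1) ^+ c *: z.
  by case: c; rewrite ?expr0 ?mul1r ?scale1r // expr1 mulN1r scaleN1r.
rewrite sE; apply/malgP => U; rewrite mcoeffZ.
rewrite !(mcoeffM U (fsubset_refl _) (fsubset_refl _)) [in RHS]exchange_big mulr_sumr.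
rewrite !big_seq; apply: eq_bigr => S /xa /eqP Sa; rewrite mulr_sumr !big_seq.
apply: eq_bigr => T /yb /eqP Tb; rewrite fsetUC mulrnAr; congr (_ *+ _).
by rewrite gr_signC Sa Tb [x@_S * _]mulrC mulrCA.
Qed.

Lemma gr_homogN a x : x \in gr_homog F a -> - x \in gr_homog F a.
Proof. by rewrite -scaleN1r; apply: gr_homogZ. Qed.

Lemma gr_monP S : gr_mon F S \in gr_homog F (odd #|` S|).
Proof.
by apply/gr_homogP => T; rewrite mcoeffU; case: (S =P T) => [->|//]; rewrite eqxx.
Qed.

Lemma gr_split x : exists x0 x1,
  [/\ x0 \in gr_homog F false, x1 \in gr_homog F true & x = x0 + x1].
Proof.
exists (\sum_(S <- msupp x | ~~ odd #|` S|) x@_S *: gr_mon F S),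
  (\sum_(S <- msupp x | odd #|` S|) x@_S *: gr_mon F S); split.
- apply: rpred_sum => S /negPf Se; rewrite gr_homogZ // -Se; exact: gr_monP.
- apply: rpred_sum => S So; rewrite gr_homogZ // -[true]So; exact: gr_monP.
- by rewrite [LHS]grassmannE (bigID (fun S : {fset nat} => odd #|` S|)) addrC.
Qed.

Lemma gr_even_central x y : x \in gr_homog F false -> x * y = y * x.
Proof.
move=> x0; have [y0 [y1 [y0P y1P ->]]] := gr_split y.
by rewrite mulrDr mulrDl (gr_homogC x0 y0P) (gr_homogC x0 y1P) !mul1r.
Qed.

(** Even elements are central, so only the odd parts contribute to the commutator, and a product of
    two odd elements is even. *)
Lemma gr_comm_central x y z : (x * y - y * x) * z = z * (x * y - y * x).
Proof.
have [x0 [x1 [x0P x1P ->]]] := gr_split x; have [y0 [y1 [y0P y1P ->]]] := gr_split y.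
have -> : (x0 + x1) * (y0 + y1) - (y0 + y1) * (x0 + x1) = x1 * y1 - y1 * x1.
  rewrite !mulrDl !mulrDr -!(gr_even_central _ x0P) !(gr_even_central _ y0P).
  exact: subr_cancel_pairs.
apply: gr_even_central; rewrite rpredD //; first exact: (gr_homogM x1P y1P).
exact/gr_homogN/(gr_homogM y1P x1P).
Qed.

Lemma gr_torsion2 : 2%:R != 0 :> F -> forall x, x + x = 0 -> x = 0.
Proof.
move=> n2 x xx; apply/malgP => S; rewrite mcoeff0.
have := congr1 (mcoeff S) xx; rewrite mcoeffD mcoeff0 => /eqP.
by rewrite -mulr2n -mulr_natl mulf_eq0 (negPf n2) => /eqP.
Qed.

(** The variable counts as even, so the coefficients alone carry the parity. *)
Definition gr_poly (b : bool) (p : {poly E}) := forall k, p`_k \in gr_homog F b.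

Lemma gr_poly1 : gr_poly false 1.
Proof. by move=> k; rewrite coef1; case: (k == 0)%N; rewrite ?gr_homog1 ?rpred0. Qed.

Lemma gr_polyB b p q : gr_poly b p -> gr_poly b q -> gr_poly b (p - q).
Proof. by move=> pb qb k; rewrite coefB rpredD ?gr_homogN. Qed.

Lemma gr_polyM a b p q : gr_poly a p -> gr_poly b q -> gr_poly (a (+) b) (p * q).
Proof.
by move=> pa qb k; rewrite coefM rpred_sum // => i _; apply: gr_homogM.
Qed.

Lemma gr_polyC a b p q : gr_poly a p -> gr_poly b q ->
  p * q = (-1) ^+ (a && b) * (q * p).
Proof.
move=> pa qb; apply/polyP => k.
have -> (c : bool) (r : {poly E}) : ((-1) ^+ c * r)`_k = (-1) ^+ c * r`_k.
  by case: c; rewrite ?expr0 ?mul1r // expr1 !mulN1r coefN.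
rewrite coefM coefMr mulr_sumr; apply: eq_bigr => i _; exact: gr_homogC.
Qed.

Lemma gr_poly_central p q : gr_poly false p -> p * q = q * p.
Proof. by move=> p0; apply: poly_central => i c; apply: gr_even_central. Qed.

End Grassmann.

(** * Diagonalization modulo powers of the variable *)

Section CoefMatrix.
Variables (R : nzRingType) (m : nat).
Local Notation M := 'M[{poly R}]_m.+1.
Implicit Types (P Q U V : M) (Y : 'M[R]_m.+1).

(** Matrices over [{poly R}] are read as polynomials in a central variable t with matrix
    coefficients. *)
Definition coef_mx k P : 'M[R]_m.+1 := map_mx (fun p : {poly R} => p`_k) P.
Definition monom_mx n Y : M := map_mx (fun a => a%:P * 'X^n) Y.
Definition eq_modX N P Q := forall k, (k < N)%N -> coef_mx k P = coef_mx k Q.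

Lemma coef_mxB k P Q : coef_mx k (P - Q) = coef_mx k P - coef_mx k Q.
Proof. by apply/matrixP => i j; rewrite !mxE coefB. Qed.

Lemma coef_mxD k P Q : coef_mx k (P + Q) = coef_mx k P + coef_mx k Q.
Proof. by apply/matrixP => i j; rewrite !mxE coefD. Qed.

Lemma coef_mxM k P Q : coef_mx k (P * Q) = \sum_(a < k.+1) coef_mx a P * coef_mx (k -
    a) Q.
Proof.
apply/matrixP => i j; rewrite summxE !mxE coef_sum.
under eq_bigr do rewrite coefM.
rewrite exchange_big; apply: eq_bigr => a _; rewrite !mxE.
by apply: eq_bigr => l _; rewrite !mxE.
Qed.

Lemma coef_monom_mx k n Y : coef_mx k (monom_mx n Y) = if k == n then Y else 0.
Proof.
apply/matrixP => i j; rewrite !mxE coefMXn coefC subn_eq0.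
by case: ltngtP => _; rewrite ?mxE.
Qed.

Lemma coef_mxM_monom k n P Y :
  coef_mx k (P * monom_mx n Y) = if (k < n)%N then 0 else coef_mx (k - n) P * Y.
Proof.
rewrite coef_mxM; case: ltnP => [kn|nk].
  by apply: big1 => a _; rewrite coef_monom_mx; case: eqP => [E|]; rewrite ?mulr0 //;
      lia.
have kn : (k - n < k.+1)%N by rewrite ltnS leq_subr.
rewrite (bigD1 (Ordinal kn)) //= subKn // coef_monom_mx eqxx big1 ?addr0 // => a.
rewrite -val_eqE /= => ak; rewrite coef_monom_mx; case: eqP => [E|]; rewrite ?mulr0 //.
by case/eqP: ak; rewrite -E subKn // -ltnS.
Qed.

Lemma coef_monom_mxM k n P Y :
  coef_mx k (monom_mx n Y * P) = if (k < n)%N then 0 else Y * coef_mx (k - n) P.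
Proof.
rewrite coef_mxM; case: ltnP => [kn|nk].
  by apply: big1 => a _; rewrite coef_monom_mx; case: eqP => [E|]; rewrite ?mul0r //;
      have := ltn_ord a; lia.
have kn : (n < k.+1)%N by [].
rewrite (bigD1 (Ordinal kn)) //= coef_monom_mx eqxx big1 ?addr0 // => a.
by rewrite -val_eqE /= => /negPf an; rewrite coef_monom_mx an mul0r.
Qed.

Lemma coef_mxMD_monom k n P Q Y : coef_mx k (P * (Q + monom_mx n Y)) =
  coef_mx k (P * Q) + if (k < n)%N then 0 else coef_mx (k - n) P * Y.
Proof. by rewrite mulrDr coef_mxD; congr (_ + _); apply: coef_mxM_monom. Qed.

Lemma coef_mxDM_monom k n P Q Y : coef_mx k ((Q + monom_mx n Y) * P) =
  coef_mx k (Q * P) + if (k < n)%N then 0 else Y * coef_mx (k - n) P.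
Proof. by rewrite mulrDl coef_mxD; congr (_ + _); apply: coef_monom_mxM. Qed.

Lemma eq_modXM N P P' Q Q' : eq_modX N P P' -> eq_modX N Q Q' -> eq_modX N (P * Q) (P'
    * Q').
Proof.
move=> PE QE k kN; rewrite !coef_mxM; apply: eq_bigr => a _.
by rewrite PE ?QE // (leq_ltn_trans _ kN) ?leq_subr // -ltnS.
Qed.

Lemma eq_modXB N P P' Q Q' : eq_modX N P P' -> eq_modX N Q Q' -> eq_modX N (P - Q) (P'
    - Q').
Proof. by move=> PE QE k kN; rewrite !coef_mxB PE ?QE. Qed.

Lemma eq_modX_refl N P : eq_modX N P P. Proof. by []. Qed.

Lemma eq_modX_sym N P Q : eq_modX N P Q -> eq_modX N Q P.
Proof. by move=> PE k kN; rewrite PE. Qed.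

Lemma eq_modX_trans N Q P U : eq_modX N P Q -> eq_modX N Q U -> eq_modX N P U.
Proof. by move=> PE QE k kN; rewrite PE ?QE. Qed.

Lemma eq_modX_nilpotent N P : coef_mx 0 P = 0 -> eq_modX N (P ^+ N) 0.
Proof.
move=> P0; have cf0 k : coef_mx k 0 = 0 by apply/matrixP => i j; rewrite !mxE coef0.
elim: N => // N IHN k kN; rewrite exprS coef_mxM cf0 big1 // => -[[|a] /= ak] _.
  by rewrite P0 mul0r.
by rewrite IHN ?cf0 ?mulr0 //; lia.
Qed.

(** 1 - U has no constant term, hence is nilpotent modulo t^N, and the geometric series inverts [U].
    The inverse is exhibited as a sum of powers of 1 - U so that [ptyped_geom] applies to it. *)
Lemma geometric_inverse N U : coef_mx 0 U = 1 -> exists q : seq nat,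
  let V := \sum_(k <- q) (1 - U) ^+ k in eq_modX N (U * V) 1 /\ eq_modX N (V * U) 1.
Proof.
move=> U1; exists (iota 0 N) => V.
have cf1 : coef_mx 0 1 = 1.
  by apply/matrixP => i j; rewrite !mxE; case: eqP; rewrite ?coef1 ?coef0.
have G0 : eq_modX N ((1 - U) ^+ N) 0 by apply: eq_modX_nilpotent; rewrite coef_mxB U1
    cf1 subrr.
have UE : U = 1 - (1 - U) by rewrite opprB addrC subrK.
have VE : V = \sum_(k < N) (1 - U) ^+ k by rewrite /V -[N in iota _ N]subn0 big_mkord.
have UV : U * V = 1 - (1 - U) ^+ N.
  by rewrite -[RHS]opprB subrX1 -mulNr opprB -UE VE.
have VU : V * U = U * V.
  rewrite VE mulr_suml mulr_sumr; apply: eq_bigr => k _; apply/esym/commrX.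
  by rewrite /GRing.comm mulrBl mulrBr mul1r mulr1.
split; rewrite ?VU UV => k kN; rewrite coef_mxB G0 //.
  by apply/matrixP => i j; rewrite !mxE coef0 subr0.
by apply/matrixP => i j; rewrite !mxE coef0 subr0.
Qed.

End CoefMatrix.

(** * Matrices with entries of prescribed parity *)

Section Typed.
Variables (F : fieldType) (m : nat) (s : bool) (par : 'I_m.+1 -> bool).
Local Notation E := (grassmann F).
Local Notation I := 'I_m.+1.

(* M_k(E) is the case s = true; M_{k,k}(E) is the case s = false, with par i
   telling in which of the two blocks the index i lies. *)
Definition entry_ok (i j : I) (x : E) : bool :=
  s || (x \in gr_homog F (par i (+) par j)).

Definition typed (M : 'M[E]_m.+1) := forall i j, entry_ok i j (M i j).

Definition ptyped (P : 'M[{poly E}]_m.+1) := forall k, typed (coef_mx k P).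

Lemma entry_ok0 i j : entry_ok i j 0.
Proof. by rewrite /entry_ok rpred0 orbT. Qed.

Lemma entry_okD i j x y : entry_ok i j x -> entry_ok i j y -> entry_ok i j (x + y).
Proof. by rewrite /entry_ok; case: s => //= *; rewrite rpredD. Qed.

Lemma entry_okZ i j c x : entry_ok i j x -> entry_ok i j (c *: x).
Proof. by rewrite /entry_ok; case: s => //= ?; rewrite gr_homogZ. Qed.

Lemma entry_okM i j k x y : entry_ok i j x -> entry_ok j k y -> entry_ok i k (x * y).
Proof.
rewrite /entry_ok; case: s => //= xP yP.
by have := gr_homogM xP yP; rewrite -addbA addKb.
Qed.

Lemma entry_okA i c : entry_ok i i c%:A.
Proof. by rewrite /entry_ok addbb gr_homogZ ?orbT ?gr_homog1. Qed.

Lemma entry_ok_sum i j K (r : seq K) (f : K -> E) :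
  (forall k, entry_ok i j (f k)) -> entry_ok i j (\sum_(k <- r) f k).
Proof.
by move=> fP; elim/big_ind: _ => // [|x y]; [apply: entry_ok0|apply: entry_okD].
Qed.

Lemma typedD M N : typed M -> typed N -> typed (M + N).
Proof. by move=> MP NP i j; rewrite mxE entry_okD. Qed.

Lemma typedB M N : typed M -> typed N -> typed (M - N).
Proof. by move=> MP NP i j; rewrite !mxE entry_okD // -scaleN1r entry_okZ. Qed.

Lemma typedM M N : typed M -> typed N -> typed (M * N).
Proof.
by move=> MP NP i j; rewrite mxE; apply: entry_ok_sum => k; apply: entry_okM.
Qed.

Lemma typed1 : typed 1.
Proof.
move=> i j; rewrite mxE; case: eqP => [->|_]; last exact: entry_ok0.
by rewrite mulr1n -[1]scale1r; apply: entry_okA.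
Qed.

Lemma typed_sum K (r : seq K) (f : K -> 'M[E]_m.+1) :
  (forall k, typed (f k)) -> typed (\sum_(k <- r) f k).
Proof. by move=> fP i j; rewrite summxE; apply: entry_ok_sum => k; apply: fP. Qed.

Lemma typed_elem_mx x i j : entry_ok i j x -> typed (elem_mx x i j).
Proof.
move=> xP a b; rewrite mxE; case: (a =P i) (b =P j) => [->|_] [->|_] //=; exact:
    entry_ok0.
Qed.

Lemma ptypedM P Q : ptyped P -> ptyped Q -> ptyped (P * Q).
Proof. by move=> PP QP k; rewrite coef_mxM; apply: typed_sum => a; apply: typedM. Qed.

Lemma ptypedB P Q : ptyped P -> ptyped Q -> ptyped (P - Q).
Proof. by move=> PP QP k; rewrite coef_mxB; apply: typedB. Qed.

Lemma typed0 : typed 0. Proof. by move=> i j; rewrite mxE entry_ok0. Qed.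

Lemma ptyped_monom_mx n Y : typed Y -> ptyped (monom_mx n Y).
Proof. by move=> YP k; rewrite coef_monom_mx; case: eqP => // _; apply: typed0. Qed.

Lemma ptypedD P Q : ptyped P -> ptyped Q -> ptyped (P + Q).
Proof. by move=> PP QP k; rewrite coef_mxD; apply: typedD. Qed.

Lemma monom_mx1 (R : nzRingType) : monom_mx 0 (1 : 'M[R]_m.+1) = 1.
Proof.
by apply/matrixP => i j; rewrite !mxE expr0 mulr1; case: eqP; rewrite ?polyC1 ?polyC0.
Qed.

Lemma ptyped1 : ptyped 1.
Proof. by rewrite -monom_mx1; apply/ptyped_monom_mx/typed1. Qed.

Lemma ptyped_geom U q : ptyped U -> ptyped (\sum_(k <- q) (1 - U) ^+ k).
Proof.
move=> UP; elim/big_ind: _ => [|P Q|k _]; first 1 last.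
- exact: ptypedD.
- elim: k => [|k IHk]; first by rewrite expr0; apply: ptyped1.
  by rewrite exprS; apply: ptypedM => //; apply: ptypedB => //; apply: ptyped1.
- by rewrite -(subrr 1); apply: ptypedB; apply: ptyped1.
Qed.

End Typed.

(** * Hensel lifting of a diagonal form *)

Section Hensel.
Variables (F : fieldType) (m : nat) (s : bool) (par : 'I_m.+1 -> bool).
Local Notation E := (grassmann F).
Local Notation I := 'I_m.+1.
Local Notation typed := (@typed F m s par).
Local Notation ptyped := (@ptyped F m s par).
Variable d : I -> F.
Hypothesis d_inj : injective d.

Definition scalar_diag : 'M[E]_m.+1 := diag_mx (\row_i (d i)%:A).

Lemma typed_scalar_diag : typed scalar_diag.
Proof.
move=> i j; rewrite !mxE; case: eqP => [->|_]; last exact: entry_ok0.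
exact: entry_okA.
Qed.

Lemma scalar_diag_mulr (Y : 'M[E]_m.+1) i j : (scalar_diag * Y) i j = d i *: Y i j.
Proof.
rewrite mxE (bigD1 i) //= big1 ?addr0 => [|k ki]; last first.
  by rewrite !mxE eq_sym (negPf ki) mul0r.
by rewrite !mxE eqxx mulr1n mulr_algl.
Qed.

Lemma mulr_scalar_diag (Y : 'M[E]_m.+1) i j : (Y * scalar_diag) i j = d j *: Y i j.
Proof.
rewrite mxE (bigD1 j) //= big1 ?addr0 => [|k kj]; last first.
  by rewrite !mxE (negPf kj) mulr0.
by rewrite !mxE eqxx mulr1n mulr_algr.
Qed.

(** Lift one power of t at a time. Adding t^n Y to [U] and t^n Z to [L] changes the coefficient of X
    U - U L at t^n by D0 Y - Y D0 - Z, with D0 the constant term of [X]. To cancel the error C, let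
    Z be its diagonal part; the rest is solved by dividing by differences of the distinct entries of
    D0. *)
Lemma hensel X N : ptyped X -> coef_mx 0 X = scalar_diag ->
  exists U (l : I -> {poly E}), let L := diag_mx (\row_i l i) in
    [/\ ptyped U, ptyped L, coef_mx 0 U = 1, coef_mx 0 L = scalar_diag & eq_modX N.+1
        (X * U) (U * L)].
Proof.
move=> XP X0; have cf1 : coef_mx 0 1 = 1 :> 'M[E]_m.+1.
  by rewrite -(@monom_mx1 m) coef_monom_mx eqxx.
elim: N => [|N [U [l [UP LP U0 L0 XU]]]].
  have LE : diag_mx (\row_i (d i)%:A%:P) = monom_mx 0 scalar_diag.
    apply/matrixP => i j; rewrite !mxE expr0 mulr1; case: eqP => [->|_].
      by rewrite !mulr1n.
    by rewrite !mulr0n polyC0.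
  exists 1, (fun i => (d i)%:A%:P); rewrite LE; split => //.
  - exact: ptyped1.
  - exact/ptyped_monom_mx/typed_scalar_diag.
  - by rewrite coef_monom_mx.
  - by case=> // _; rewrite mulr1 mul1r coef_monom_mx eqxx.
set L := diag_mx _ in LP L0 XU.
have [C C_def] : exists C, C = coef_mx N.+1 (X * U - U * L) by eexists.
have CP : typed C by rewrite C_def; move=> i j; apply: ptypedB; apply: ptypedM.
(* Y solves the off-diagonal part of D0 Y - Y D0 = Z - C; its diagonal is zero
   because 0^-1 = 0. *)
pose Y : 'M[E]_m.+1 := \matrix_(i, j) ((d j - d i)^-1 *: C i j).
have YP : typed Y by move=> i j; rewrite mxE entry_okZ ?CP.
pose Z : 'M[E]_m.+1 := diag_mx (\row_i C i i).
have ZP : typed Z.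
  by move=> i j; rewrite !mxE; case: eqP => [->|_]; [apply: CP|apply: entry_ok0].
exists (U + monom_mx N.+1 Y), (fun i => l i + (C i i)%:P * 'X^(N.+1)).
have -> : diag_mx (\row_i (l i + (C i i)%:P * 'X^(N.+1))) = L + monom_mx N.+1 Z.
  apply/matrixP => i j; rewrite !mxE; case: eqP => [->|]; rewrite ?mulr1n //.
  by rewrite !mulr0n polyC0 mul0r addr0.
move=> L'; rewrite {}/L'; split.
- by apply: ptypedD => //; apply: ptyped_monom_mx.
- by apply: ptypedD => //; apply: ptyped_monom_mx.
- by rewrite coef_mxD coef_monom_mx addr0.
- by rewrite coef_mxD coef_monom_mx addr0.
move=> k; rewrite ltnS leq_eqVlt.
rewrite [LHS]coef_mxMD_monom [RHS]coef_mxDM_monom [X in _ = X + _]coef_mxMD_monom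
    coef_mxD.
case/orP => [/eqP->|kN]; last by rewrite kN !addr0 XU.
rewrite ltnn subnn X0 U0 L0 coef_monom_mx /= addr0 mul1r.
apply/matrixP => i j.
have addE (A B : 'M[E]_m.+1) : (A + B) i j = A i j + B i j by rewrite mxE.
have CE : coef_mx N.+1 (X * U) i j = C i j + coef_mx N.+1 (U * L) i j.
  by rewrite C_def coef_mxB addE [X in _ + X + _]mxE subrK.
rewrite [LHS]addE [RHS]addE [X in _ = X + _]addE CE scalar_diag_mulr mulr_scalar_diag.
rewrite [Y i j]mxE [Z i j]mxE [X in X *+ _]mxE.
have [->|ij] := eqVneq i j.
  by rewrite subrr invr0 !scale0r !scaler0 mulr1n !addr0 addrC.
rewrite mulr0n addr0 [C i j + _]addrC -addrA; congr (_ + _).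
rewrite !scalerA -[X in X + _]scale1r -scalerDl; congr (_ *: _).
have dn : d j - d i != 0 by rewrite subr_eq0 (inj_eq d_inj) eq_sym.
by rewrite -[1](mulfV dn) -mulrDl subrK.
Qed.

End Hensel.

Lemma scalar_mx_central (R : nzRingType) m (K : R) (U : 'M[R]_m.+1) :
  (forall c, K * c = c * K) -> K%:M * U = U * K%:M.
Proof.
move=> KC; apply/matrixP => i j; rewrite !mxE (bigD1 i) //= [RHS](bigD1 j) //=.
rewrite !mxE !eqxx !mulr1n KC; congr (_ + _).
rewrite !big1 // => k /negPf kj; rewrite mxE ?kj ?mulr0 //.
by rewrite eq_sym kj mul0r.
Qed.

Lemma mul_mx00 (R : nzRingType) m (A B : 'M[R]_m.+1) :
  (forall k, k != ord0 -> A ord0 k = 0) ->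
  (A * B) ord0 ord0 = A ord0 ord0 * B ord0 ord0.
Proof.
by move=> A0; rewrite mxE (bigD1 ord0) //= big1 ?addr0 // => k /A0->; rewrite mul0r.
Qed.

(** * Centrality at arbitrary matrices *)

Section Central.
Variables (F : fieldType) (m : nat) (s : bool) (par : 'I_m.+1 -> bool).
Local Notation E := (grassmann F).
Local Notation I := 'I_m.+1.
Local Notation typed := (@typed F m s par).
Local Notation ptyped := (@ptyped F m s par).
Hypothesis n2 : 2%:R != 0 :> F.
Variable d : I -> F.
Hypothesis d_inj : injective d.
Local Notation scalar_diag := (scalar_diag d).

Lemma formanek_central_ptyped_diag (l : I -> {poly E}) (y z : I -> 'M[{poly E}]_m.+1) :
    ptyped (diag_mx (\row_i l i)) -> (forall p, ptyped (y p)) ->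
    (forall p, ptyped (z p)) ->
  exists2 K : {poly E}, (forall c, K * c = c * K) &
    formanek_central s (diag_mx (\row_i l i)) y z = K%:M.
Proof.
move=> lP yP zP.
have cc := poly_comm_central (@gr_comm_central F).
have t2 := poly_torsion2 (gr_torsion2 n2).
case: s lP yP zP => lP yP zP.
  exact: formanek_central_diag_comm.
have [|||||||K KP KE] := @formanek_central_diag_super _ _ cc t2 l (@gr_poly F) par _ _
    _ _ _ y z.
- exact: gr_poly1.
- exact: gr_polyB.
- exact: gr_polyM.
- exact: gr_polyC.
- by move=> i k; have := lP k i i; rewrite /entry_ok !mxE eqxx addbb.
- by move=> p i j k; have := yP p k i j; rewrite /entry_ok mxE.
- by move=> p i j k; have := zP p k i j; rewrite /entry_ok mxE.
by exists K => // c; apply: gr_poly_central.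
Qed.

(** The relation P U = U Q modulo a power of t is compatible with the ring operations and links [X]
    with its diagonal form and [y p] with V (y p) U. Hence the value at [X] times [U] is U K = K U,
    and [U] cancels. *)
Lemma formanek_central_ptyped N X (y z : I -> 'M[{poly E}]_m.+1) :
    ptyped X -> coef_mx 0 X = scalar_diag -> (forall p, ptyped (y p)) ->
    (forall p, ptyped (z p)) ->
  exists2 K : {poly E}, (forall c, K * c = c * K) & eq_modX N (formanek_central s X y
      z) K%:M.
Proof.
move=> XP X0 yP zP; have [U [l [UP LP U0 _ XU]]] := hensel d_inj N XP X0.
have [q [UV VU]] := geometric_inverse N.+1 U0.
move: (ptyped_geom q UP) UV VU; set V := \sum_(k <- q) _ => VP UV VU.
have [||K KC KE] := formanek_central_ptyped_diag (y := fun p => V * y p * U)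
   (z := fun p => V * z p * U) LP.
- by move=> p; do 2 apply: ptypedM => //.
- by move=> p; do 2 apply: ptypedM => //.
exists K => //.
have conj Y : eq_modX N.+1 (Y * U) (U * (V * Y * U)).
  have -> : U * (V * Y * U) = (U * V) * (Y * U) by rewrite !mulrA.
  by rewrite -{1}[Y * U]mul1r; apply: eq_modXM => //; apply: eq_modX_sym.
have : eq_modX N.+1 (formanek_central s X y z * U) (U * K%:M).
  rewrite -KE; apply: (@formanek_central_rel _ _ _ (fun P Q => eq_modX N.+1 (P * U) (U
      * Q))) => //.
  - by rewrite mul1r mulr1.
  - by move=> a a' b b' aE bE; rewrite mulrBl mulrBr; apply: eq_modXB.
  - move=> a a' b b' aE bE; rewrite -mulrA; apply: (eq_modX_trans (eq_modXM
      (eq_modX_refl a) bE)).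
    by rewrite !mulrA; apply: eq_modXM.
rewrite -(scalar_mx_central _ KC) => cE k kN.
have {}cE : eq_modX N.+1 (formanek_central s X y z * (U * V)) (K%:M * (U * V)).
  by rewrite !mulrA; apply: eq_modXM.
have h P : eq_modX N.+1 (P * (U * V)) P.
  by rewrite -{2}[P]mulr1; apply: eq_modXM.
by rewrite -(h _ k (ltnW kN)) cE; [exact: (h K%:M k (ltnW kN))|exact: ltnW].
Qed.

(* Apply the previous lemma to X = D0 + (x - D0) t for every N, and put t = 1. *)
Lemma formanek_central_typed (x : 'M[E]_m.+1) (y z : I -> 'M[E]_m.+1) :
    typed x -> (forall p, typed (y p)) -> (forall p, typed (z p)) ->
  exists2 k : E, (forall c, k * c = c * k) & formanek_central s x y z = k%:M.
Proof.
move=> xP yP zP; pose X := monom_mx 0 scalar_diag + monom_mx 1 (x - scalar_diag).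
have XP : ptyped X.
  by apply: ptypedD; apply: ptyped_monom_mx; [|apply: typedB => //]; apply:
      typed_scalar_diag.
have X0 : coef_mx 0 X = scalar_diag by rewrite coef_mxD !coef_monom_mx addr0.
have yP' p : ptyped (monom_mx 0 (y p)) by apply: ptyped_monom_mx.
have zP' p : ptyped (monom_mx 0 (z p)) by apply: ptyped_monom_mx.
pose c := formanek_central s X (fun p => monom_mx 0 (y p)) (fun p => monom_mx 0 (z p)).
pose at1 (P : 'M[{poly E}]_m.+1) (Q : 'M[E]_m.+1) := forall i j, (P i j).[1] = Q i j.
have cE : at1 c (formanek_central s x y z).
  apply: formanek_central_rel; rewrite /at1.
  - by move=> i j; rewrite !mxE; case: eqP; rewrite ?hornerC.
  - by move=> a a' b b' aE bE i j; rewrite !mxE hornerD hornerN aE bE.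
  - move=> a a' b b' aE bE i j; rewrite !mxE horner_sum; apply: eq_bigr => k _.
    rewrite hornerM_comm; first by rewrite aE bE.
    by rewrite /comm_poly mulr1 mul1r.
  - move=> i j; rewrite !mxE hornerD expr0 mulr1 expr1 hornerMX !hornerC mulr1.
    by rewrite addrCA subrr addr0.
  - by move=> p i j; rewrite !mxE expr0 mulr1 hornerC.
  - by move=> p i j; rewrite !mxE expr0 mulr1 hornerC.
have cK k : exists2 K : {poly E}, (forall c, K * c = c * K) & coef_mx k c = coef_mx k
    K%:M.
  by have [K KC KE] := formanek_central_ptyped k.+1 XP X0 yP' zP'; exists K => //;
      apply: KE.
exists (c ord0 ord0).[1] => [e|].
  rewrite horner_coef mulr_suml mulr_sumr; apply: eq_bigr => k _.
  rewrite expr1n mulr1; have [K KC /matrixP/(_ ord0 ord0)] := cK k.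
  rewrite !mxE eqxx mulr1n => ->.
  by have /polyP/(_ k) := KC e%:P; rewrite coefMC coefCM.
apply/matrixP => i j; rewrite -cE [RHS]mxE.
have -> : c i j = c ord0 ord0 *+ (i == j).
  apply/polyP => k; rewrite coefMn; have [K KC /matrixP KE] := cK k.
  move: (KE i j) (KE ord0 ord0); rewrite !mxE eqxx coefMn mulr1n => -> ->.
  by [].
by rewrite hornerMn.
Qed.

(** At a diagonal matrix [formanek] is diagonal, so the entries at [ord0] multiply; the constant is
    the square of the one in [formanek_cycle]. *)
Lemma formanek_central_cycle (g h : I -> E) : exists2 w : F, w != 0 &
  formanek_central s scalar_diag (fun p => elem_mx (g p) p (cyc_perm m p)) (fun p =>
      elem_mx (h p) p (cyc_perm m p))
    ord0 ord0 =
  w *: (if s then \prod_p g p * \prod_p h p - \prod_p h p * \prod_p g p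
        else \prod_p g p * \prod_p h p).
Proof.
have cc := @gr_comm_central F; have t2 := gr_torsion2 n2.
have [w w0 wE] := formanek_cycle cc t2 d_inj.
exists (w * w); first by rewrite mulf_neq0.
have FM (u v : I -> 'M[E]_m.+1) : (formanek scalar_diag u * formanek scalar_diag v)
    ord0 ord0
    = formanek scalar_diag u ord0 ord0 * formanek scalar_diag v ord0 ord0.
  have F0 k : k != ord0 -> formanek scalar_diag u ord0 k = 0.
    by move=> k0; apply: (formanek_offdiag cc t2); rewrite eq_sym.
  exact: mul_mx00.
have FE f f' : formanek scalar_diag (fun p => elem_mx (f p) p (cyc_perm m p)) ord0
    ord0 *
    formanek scalar_diag (fun p => elem_mx (f' p) p (cyc_perm m p)) ord0 ord0 =
    (w * w) *: (\prod_p f p * \prod_p f' p).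
  transitivity ((w *: \prod_p f p) * (w *: \prod_p f' p)).
    by congr (_ * _); apply: wE.
  by rewrite -scalerAl -scalerAr scalerA.
rewrite /formanek_central; case: s; last by rewrite FM FE.
have subE (A B : 'M[E]_m.+1) : (A - B) ord0 ord0 = A ord0 ord0 - B ord0 ord0.
  by rewrite !mxE.
by rewrite [LHS]subE scalerBr; congr (_ - _); exact: etrans (FM _ _) (FE _ _).
Qed.


End Central.

(** * Evaluation of polynomials *)

Section Eval.
Variable F : fieldType.

(** Stated for bare functions: it is used for embeddings, for conjugations and for the renaming of
    generators. *)
Lemma peval_morph (A B : algType F) (phi : A -> B) (a : nat -> A) (f : freealg F) :
    (forall x y, phi (x + y) = phi x + phi y) ->
    (forall x y, phi (x * y) = phi x * phi y) -> phi 1 = 1 ->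
    (forall c x, phi (c *: x) = c *: phi x) ->
  phi (peval a f) = peval (phi \o a) f.
Proof.
move=> phiD phiM phi1 phiZ.
have phi0 : phi 0 = 0 by rewrite -(scale0r 0) phiZ scale0r.
rewrite /peval /mmap (big_morph phi phiD phi0); apply: eq_bigr => k _.
rewrite phiM /= phiZ phi1; congr (_ * _).
exact: (big_morph phi phiM phi1).
Qed.

Lemma peval_in_vars (A : algType F) (P : pred nat) (a b : nat -> A) (f : freealg F) :
  in_vars P f -> (forall i, P i -> a i = b i) -> peval a f = peval b f.
Proof.
move=> fP ab; rewrite /peval /mmap !big_seq; apply: eq_bigr => k /fP /allP kP.
congr (_ * _); rewrite /fmeval !big_seq; apply: eq_bigr => i /kP; exact: ab.
Qed.

Lemma peval0 (A : algType F) (f : freealg F) :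
  peval (fun=> 0 : A) f = (f@_(mone : {fmonom nat}))%:A.
Proof.
have le1 : (msupp f `<=` mone |` msupp f)%fset by apply: fsubsetUr.
rewrite /peval (mmapEw le1) (big_fsetD1 mone) ?fset1U1 //= big_seq big1 ?addr0.
  by rewrite mmorph1 mulr1.
move=> k; rewrite in_fsetD1 => /andP[k1 _].
rewrite /fmeval; case E : (k : seq nat) => [|i t]; last by rewrite big_cons mul0r mulr0.
by case/eqP: k1; apply: val_inj; rewrite /= E fm1.
Qed.

(** Variable 0 stands for x, variables 1 to m+1 for the y_p, and variables m+2 to 2m+2 for the
    z_p. *)
Definition formanek_polynomial (s : bool) (m : nat) : freealg F :=
  formanek_central s << fmu 0 >> (fun p : 'I_m.+1 => << fmu p.+1 >>)
    (fun p : 'I_m.+1 => << fmu (p + m.+2)%N >>).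

Lemma peval_formanek (A : algType F) (a : nat -> A) s m :
  peval a (formanek_polynomial s m) =
    formanek_central s (a 0) (fun p : 'I_m.+1 => a p.+1) (fun p : 'I_m.+1 => a (p +
        m.+2)%N).
Proof.
apply: (@formanek_central_rel _ _ _ (fun f b => peval a f = b)) => [|b b' c c' bE cE|b
    b' c c' bE cE||p|p].
- exact: peval1.
- by rewrite pevalD -scaleN1r pevalZ bE cE scaleN1r.
- by rewrite pevalM bE cE.
- exact: peval_var.
- exact: peval_var.
- exact: peval_var.
Qed.

Lemma formanek_central0 (B : nzRingType) s m :
  formanek_central s 0 (fun _ : 'I_m.+1 => 0) (fun _ : 'I_m.+1 => 0) = 0 :> B.
Proof.
have F0 : formanek 0 (fun _ : 'I_m.+1 => 0 : B) = 0.
  apply: big1 => r _; apply: big1 => w _.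
  by rewrite big_ord_recl mulr0 !mul0r mulr0.
by rewrite /formanek_central F0 mul0r; case: s; rewrite ?subrr.
Qed.

(** The constant term is the value at zero, where every product in [formanek] contains a zero
    factor. *)
Lemma no_constant_formanek s m : no_constant_term (formanek_polynomial s m).
Proof.
have := peval0 (grassmann F) (formanek_polynomial s m).
rewrite peval_formanek formanek_central0 => /esym/eqP.
by rewrite scaler_eq0 oner_eq0 orbF => /eqP.
Qed.

End Eval.

(** * Passage from an algebra to typed matrices *)

Section Transport.
Variables (F : fieldType) (A : algType F) (m : nat).
Variables (s : bool) (par : 'I_m.+1 -> bool).
Local Notation B := (matalg (grassmann F) m).
Local Notation typed := (@typed F m s par).
Variables (iota : A -> B) (kappa : B -> A).
Hypothesis iotaD : forall x y, iota (x + y) = iota x + iota y.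
Hypothesis iotaM : forall x y, iota (x * y) = iota x * iota y.
Hypothesis iota1 : iota 1 = 1.
Hypothesis iotaZ : forall c x, iota (c *: x) = c *: iota x.
Hypothesis iota_inj : injective iota.
Hypothesis iota_typed : forall x, typed (iota x).
Hypothesis kappaK : forall M, typed M -> iota (kappa M) = M.

(** Centrality for the subalgebra of typed matrices, phrased inside the full matrix algebra by
    restricting assignments and test elements. *)
Definition tcentral (f : freealg F) := forall a : nat -> B,
  (forall i, typed (a i)) -> forall M : B, typed M -> peval a f * M = M * peval a f.

Definition tident (f : freealg F) := forall a : nat -> B,
  (forall i, typed (a i)) -> peval a f = 0.

Lemma central_typed f : central_polynomial A f <-> tcentral f.
Proof.
split=> [fc a aP M MP|fc a b].
  have E : iota (peval (kappa \o a) f) = peval a f.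
    rewrite (peval_morph _ _ iotaD iotaM iota1 iotaZ).
    by apply: (@peval_in_vars _ _ predT) => [? ? |i _ /=]; [apply/allP|apply: kappaK].
  by rewrite -E -(kappaK MP) -!iotaM fc.
apply: iota_inj; rewrite !iotaM (peval_morph _ _ iotaD iotaM iota1 iotaZ).
by apply: fc => [i|]; apply: iota_typed.
Qed.

Lemma ident_typed f : polynomial_identity A f <-> tident f.
Proof.
have iota0 : iota 0 = 0 by rewrite -(scale0r 0) iotaZ scale0r.
split=> [fi a aP|fi a].
  have <- : iota (peval (kappa \o a) f) = peval a f.
    rewrite (peval_morph _ _ iotaD iotaM iota1 iotaZ).
    by apply: (@peval_in_vars _ _ predT) => [? ? |i _ /=]; [apply/allP|apply: kappaK].
  by rewrite fi.
apply: iota_inj; rewrite iota0 (peval_morph _ _ iotaD iotaM iota1 iotaZ).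
by apply: fi => i; apply: iota_typed.
Qed.

(** If [f] or [g] were an identity, so would be [f * g]; this reduces primeness to the centrality of
    both factors. *)
Lemma primeness_typed :
    (exists f, [/\ no_constant_term f, tcentral f & ~ tident f]) ->
    (forall (r t : nat) f g, in_vars [pred i | (i < r)%N] f ->
       in_vars [pred i | (r <= i < t)%N] g -> tcentral (f * g) -> ~ tident (f * g) ->
       tcentral f /\ tcentral g) ->
  primeness_property F A.
Proof.
move=> [f0 [f0c f0t f0i]] H; split.
  by exists f0; split=> //; split; [apply/central_typed|move/ident_typed].
move=> r t f g fr gt [/central_typed fgc fgi].
have [|fc gc] := H r t f g fr gt fgc; first by move/ident_typed.
have iz (u v : freealg F) : polynomial_identity A u \/ polynomial_identity A v ->
    polynomial_identity A (u * v).
  by move=> uv a; rewrite pevalM; case: uv => ->; rewrite ?mul0r ?mulr0.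
split; (split; first exact/central_typed) => fi; apply: fgi; apply: iz; by [left|right].
Qed.

End Transport.

Lemma prod_natD (R : pzRingType) (n n' : nat) (f : nat -> R) :
  \prod_(0 <= k < n + n') f k =
    \prod_(0 <= k < n) f k * \prod_(0 <= k < n') f (n + k)%N.
Proof.
rewrite (@big_cat_nat _ _ _ n) ?leq_addr //=; congr (_ * _).
rewrite -{1}[n]add0n big_addn addKn.
by apply: eq_bigr => k _; rewrite addnC.
Qed.

(** * Existence of proper central polynomials *)

Section Existence.
Variables (F : fieldType) (m : nat) (s : bool) (par : 'I_m.+1 -> bool).
Local Notation E := (grassmann F).
Hypothesis charF0 : [pchar F] =i pred0.

(** Distinct generators in increasing order multiply to a basis monomial. *)
Lemma gr_prod_gen_neq0 (c : pred nat) n : \prod_(0 <= k < n | c k) gr_gen F k != 0.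
Proof.
rewrite -big_filter -gr_mon_prod; last first.
  by apply: sorted_filter; [apply: ltn_trans|apply: iota_ltn_sorted].
apply/eqP => /malgP /(_ [fset i in [seq k <- index_iota 0 n | c k]]%fset) /eqP.
by rewrite mcoeffUU mcoeff0 oner_eq0.
Qed.

Lemma typed_central_exists :
  exists f : freealg F,
    [/\ no_constant_term f, tcentral s par f & ~ tident s par f].
Proof.
have n2 : 2%:R != 0 :> F by have /pcharf0P -> := charF0.
(* The eigenvalues 0, ..., m are distinct in characteristic zero. *)
pose d (i : 'I_m.+1) : F := i%:R.
have d_inj : injective d.
  move=> i j /eqP; rewrite /d; wlog le_ij : i j / (i <= j)%N => [H|].
    by case: (leqP i j) => [/H//|/ltnW/H ji]; rewrite eq_sym => /ji.
  rewrite eq_sym -subr_eq0 -natrB //; have /pcharf0P -> := charF0.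
  by rewrite subn_eq0 => le_ji; apply/val_inj/eqP; rewrite eqn_leq le_ij.
exists (formanek_polynomial F s m); split; first exact: no_constant_formanek.
  move=> a aP M MP; rewrite peval_formanek.
  have [|p|p|k kC ->] := @formanek_central_typed F m s par n2 d d_inj (a 0)
    (fun p => a p.+1) (fun p => a (p + m.+2)%N); rewrite ?scalar_mx_central //.
have [g [h [gP hP gh]]] : exists g h : 'I_m.+1 -> E,
  [/\ forall p, entry_ok s par p (cyc_perm m p) (g p),
      forall p, entry_ok s par p (cyc_perm m p) (h p) &
      (if s then \prod_p g p * \prod_p h p - \prod_p h p * \prod_p g p
        else \prod_p g p * \prod_p h p) != 0].
  rewrite /entry_ok; case: s => /=.
    (* The two products are e_0 and e_1, whose commutator is 2 e_0 e_1. *)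
    exists (fun p => if p == ord0 then gr_gen F 0 else 1),
      (fun p => if p == ord0 then gr_gen F 1 else 1); split => //.
    have G1 (x : E) : \prod_(p < m.+1) (if p == ord0 then x else 1) = x.
      by rewrite big_ord_recl big1 ?mulr1.
    rewrite !G1 gr_genC -opprD oppr_eq0.
    apply: contra_neq (gr_prod_gen_neq0 predT 2) => /(gr_torsion2 n2) E0.
    by rewrite unlock /= mulr1 gr_genC E0 oppr0.
  (* An edge of the cycle carries a generator if its ends differ in parity, and 1 otherwise. The
     edges of the second cycle are numbered from [m.+1] on, so that the generators occur in
     increasing order. *)
  pose c k := let p : 'I_m.+1 := inord (k %% m.+1) in par p != par (cyc_perm m p).
  have genP (p : 'I_m.+1) k : (k %% m.+1)%N = p ->
      (if c k then gr_gen F k else 1) \in gr_homog F (par p (+) par (cyc_perm m p)).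
    rewrite /c => ->; rewrite inord_val; case: eqP => [->|] /=.
      by rewrite addbb gr_homog1.
    move=> pp; have -> : par p (+) par (cyc_perm m p) by case: (par p) (par (cyc_perm
        m p)) pp => [] [].
    by have := gr_monP F [fset k]%fset; rewrite cardfs1.
  exists (fun p => if c p then gr_gen F p else 1),
     (fun p => if c (m.+1 + p)%N then gr_gen F (m.+1 + p) else 1); split.
  - by move=> p; apply: genP; rewrite modn_small.
  - by move=> p; apply: genP; rewrite modnDl modn_small.
  rewrite -(big_mkord xpredT (fun k => if c k then gr_gen F k else 1)).
  rewrite -(big_mkord xpredT (fun k => if c (m.+1 + k)%N then gr_gen F (m.+1 + k) else
      1)).
  by have := gr_prod_gen_neq0 c (m.+1 + m.+1); rewrite big_mkcond prod_natD.
have [w w0 wE] := formanek_central_cycle s n2 d_inj g h.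
(* The assignment follows the numbering of variables in [formanek_polynomial]; beyond them [inord]
   still returns an index, so every variable receives a typed matrix. *)
pose a (k : nat) : matalg E m := if k is k'.+1 then
  (if (k' <= m)%N then elem_mx (g (inord k')) (inord k') (cyc_perm m (inord k'))
   else elem_mx (h (inord (k' - m.+1))) (inord (k' - m.+1)) (cyc_perm m (inord (k' -
       m.+1))))
  else scalar_diag d.
move=> /(_ a)/(_ _)/[!peval_formanek] H.
have {}H : formanek_central s (scalar_diag d) (fun p => elem_mx (g p) p (cyc_perm m p))
    (fun p => elem_mx (h p) p (cyc_perm m p)) = 0.
  rewrite -H.
    apply: (@formanek_central_rel _ _ _ eq) => [//|? ? ? ? -> ->//|? ? ? ? ->
        ->//|//|p|p].
      by rewrite /a -ltnS ltn_ord inord_val.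
    rewrite addnS /a ifF ?addnK ?inord_val //.
    by apply/negbTE; rewrite -ltnNge addnS ltnS leq_addl.
  move=> i; rewrite /a; case: i => [|k]; first exact: typed_scalar_diag.
  by case: ifP => _; apply: typed_elem_mx.
move: wE; rewrite H mxE => /esym/eqP; rewrite scaler_eq0 (negPf w0).
by rewrite (negPf gh).
Qed.

End Existence.

Local Open Scope fset_scope.
Local Open Scope ring_scope.

(** * The primeness property *)

Section Coefficients.
Variable F : fieldType.
Local Notation E := (grassmann F).
Implicit Types (x y z : E) (S T U : {fset nat}) (h : nat).

Definition fset_lt S h := forall t, t \in S -> (t < h)%N.
Definition gr_lt x h := forall S, S \in msupp x -> fset_lt S h.

(** The bound holds for all [h] from [h0] on, so that the bounds for the finitely many entries of a
    matrix can be combined. *)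
Lemma gr_lt_exists x S : exists h0, forall h, (h0 <= h)%N -> gr_lt x h /\ fset_lt S h.
Proof.
have fP (T : {fset nat}) t : t \in T -> (t < \max_(u <- T) u.+1)%N.
  by move=> tT; apply: (@leq_bigmax_seq _ _ xpredT (fun u => u.+1)).
exists (maxn (\max_(T <- msupp x) \max_(t <- T) t.+1) (\max_(t <- S) t.+1)) => h.
rewrite geq_max => /andP[hx hS]; split=> [T Tx t tT|t tS].
  apply: leq_trans (fP _ _ tT) (leq_trans _ hx).
  exact: (@leq_bigmax_seq _ _ xpredT (fun T : {fset nat} => \max_(t <- T) t.+1)%N).
exact: leq_trans (fP _ _ tS) hS.
Qed.

Lemma gr_sign_lt S T h : fset_lt S h -> (forall t, t \in T -> (h <= t)%N) ->
  gr_sign F S T = 1.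
Proof.
move=> Sh Th; rewrite /gr_sign ifT.
  rewrite /gr_inv big_seq big1 ?expr0 // => t tS; rewrite big_seq big1 // => u uT.
  by rewrite ltnNge ltnW // (leq_trans (Sh _ tS) (Th _ uT)).
apply/fdisjointP => t /Sh tlt; apply/negP => /Th; by rewrite leqNgt tlt.
Qed.

(* Monomials of x and y are separated by h, so a monomial of x * y determines
   its two factors. *)
Lemma mcoeffM_lt x y h S T : gr_lt x h -> fset_lt S h ->
    (forall U, U \in msupp y -> forall t, t \in U -> (h <= t)%N) ->
    (forall t, t \in T -> (h <= t)%N) ->
  (x * y)@_(S `|` T) = x@_S * y@_T.
Proof.
move=> xh Sh yh Th.
have l1 : msupp x `<=` S |` msupp x by apply: fsubsetUr.
have l2 : msupp y `<=` T |` msupp y by apply: fsubsetUr.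
have P1 S' : S' \in S |` msupp x -> fset_lt S' h.
  by rewrite in_fset1U => /orP[/eqP->|/xh].
have P2 T' : T' \in T |` msupp y -> forall t, t \in T' -> (h <= t)%N.
  by rewrite in_fset1U => /orP[/eqP->|/yh].
have inj S' T' : S' \in S |` msupp x -> T' \in T |` msupp y ->
    S' `|` T' = S `|` T -> S' = S /\ T' = T.
  move=> /P1 S'h /P2 T'h /fsetP EU; split; apply/fsetP => t.
    have := EU t; rewrite !in_fsetU; case: (ltnP t h) => th.
      have /negbTE -> : t \notin T' by apply/negP => /T'h; rewrite leqNgt th.
      have /negbTE -> : t \notin T by apply/negP => /Th; rewrite leqNgt th.
      by rewrite !orbF.
    have /negbTE -> : t \notin S by apply/negP => /Sh; rewrite ltnNge th.
    by have /negbTE -> : t \notin S' by apply/negP => /S'h; rewrite ltnNge th.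
  have := EU t; rewrite !in_fsetU; case: (ltnP t h) => th.
    have /negbTE -> : t \notin T' by apply/negP => /T'h; rewrite leqNgt th.
    by have /negbTE -> : t \notin T by apply/negP => /Th; rewrite leqNgt th.
  have /negbTE -> : t \notin S by apply/negP => /Sh; rewrite ltnNge th.
  by have /negbTE -> : t \notin S' by apply/negP => /S'h; rewrite ltnNge th.
rewrite (mcoeffM _ l1 l2) (bigD1_seq S) ?fset1U1 ?fset_uniq //=.
rewrite (bigD1_seq T) ?fset1U1 ?fset_uniq //= eqxx mulr1n (gr_sign_lt Sh Th) mulr1.
rewrite big_seq_cond big1 ?addr0 => [|T' /andP[T'T nT]]; last first.
  by case: eqP => // /(inj _ _ (fset1U1 _ _) T'T)[_ /eqP]; rewrite (negPf nT).
rewrite big_seq_cond big1 ?addr0 // => S' /andP[S'S nS].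
rewrite big_seq big1 // => T' T'T.
by case: eqP => // /(inj _ _ S'S T'T)[/eqP]; rewrite (negPf nS).
Qed.

Lemma gr_gen_homog h : gr_gen F h \in gr_homog F true.
Proof. by have := gr_monP F [fset h]; rewrite cardfs1. Qed.

Lemma mcoeff_Mgen x h S : gr_lt x h -> fset_lt S h ->
  (x * gr_gen F h)@_(S `|` [fset h]) = x@_S.
Proof.
move=> xh Sh; rewrite (mcoeffM_lt (h := h)) //.
- by rewrite mcoeffUU mulr1.
- move=> U; rewrite msuppU oner_eq0 in_fset1 => /eqP -> t.
  by rewrite in_fset1 => /eqP->.
- by move=> t; rewrite in_fset1 => /eqP->.
Qed.

(** Moving e_h past e_S costs the sign (-1)^|S|. *)
Lemma mcoeff_genM x h S : gr_lt x h -> fset_lt S h ->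
  (gr_gen F h * x)@_(S `|` [fset h]) = (-1) ^+ odd #|` S| * x@_S.
Proof.
move=> xh Sh; rewrite -[x@_S](mcoeff_Mgen xh Sh).
have l1 : msupp (gr_gen F h) `<=` [fset [fset h]] by apply: msuppU_le.
rewrite [LHS](mcoeffM _ l1 (fsubset_refl _)) [X in _ * X](mcoeffM _ (fsubset_refl _)
    l1).
rewrite big_seq_fset1 mulr_sumr !big_seq; apply: eq_bigr => T Tx.
rewrite big_seq_fset1 fsetUC mulrnAr; case: eqP => // E; rewrite !mulr1n.
have <- : T = S.
  have nh U : fset_lt U h -> (h \in U) = false.
    by move=> Uh; apply/negP => /Uh; rewrite ltnn.
  apply/fsetP => t; have /fsetP/(_ t) := E; rewrite !in_fsetU in_fset1.
  by case: eqP => [->|_]; rewrite ?orbF // !nh //; apply: xh.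
by rewrite gr_signC cardfs1 /= mulrCA [_ * x@_T]mulrC.
Qed.

Lemma gr_gen_sq h : gr_gen F h * gr_gen F h = 0.
Proof. by rewrite /gr_gen gr_monM /gr_sign fdisjoint1X in_fset1 eqxx scale0r. Qed.

(** Up to sign e_h can be moved past each homogeneous part of [x], and its square is zero. *)
Lemma gr_gen_sandwich h x : gr_gen F h * x * gr_gen F h = 0.
Proof.
have gP := gr_gen_homog h; set g := gr_gen F h in gP *.
have gg : g * g = 0 by exact: gr_gen_sq.
have gxg b u : u \in gr_homog F b -> g * u * g = 0.
  by move=> /(gr_homogC gP)->; rewrite -mulrA -mulrA gg !mulr0.
have [x0 [x1 [/gxg x0P /gxg x1P ->]]] := gr_split x.
by rewrite mulrDr mulrDl; apply: etrans (congr2 +%R x0P x1P) (addr0 _).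
Qed.

(** * Renaming the generators *)

Definition shiftS h S : {fset nat} := [fset (h + t)%N | t in S].

Lemma mem_shiftS h S t : t \in shiftS h S -> (h <= t)%N.
Proof. by case/imfsetP => u _ ->; apply: leq_addr. Qed.

Lemma shiftS_inj h : injective (shiftS h).
Proof.
have H S T : shiftS h S = shiftS h T -> {subset S <= T}.
  move=> E t tS; have : (h + t)%N \in shiftS h T by rewrite -E in_imfset.
  by case/imfsetP => u uT /addnI->.
by move=> S T E; apply/fsetP => t; apply/idP/idP; apply: H.
Qed.

Lemma perm_shiftS h S : perm_eq (shiftS h S) [seq (h + t)%N | t <- S].
Proof.
apply: uniq_perm; rewrite ?fset_uniq ?map_inj_uniq ?fset_uniq //; first by move=> t u
    /addnI.
by move=> t; apply/imfsetP/mapP => -[u uS ->]; exists u.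
Qed.

Lemma card_shiftS h S : #|` shiftS h S| = #|` S|.
Proof. by rewrite card_imfset //= => t u /addnI. Qed.

Lemma odd_card_shiftS h S T : fset_lt S h ->
  odd #|` S `|` shiftS h T| = odd #|` S| (+) odd #|` T|.
Proof.
move=> Sh; rewrite cardfsU (_ : S `&` _ = fset0).
  by rewrite cardfs0 subn0 oddD card_shiftS.
apply/fsetP => u; rewrite in_fsetI in_fset0; apply/negP => /andP[/Sh uh /mem_shiftS].
by rewrite leqNgt uh.
Qed.

Lemma gr_sign_shift h S T : gr_sign F (shiftS h S) (shiftS h T) = gr_sign F S T.
Proof.
rewrite /gr_sign; have -> : [disjoint shiftS h S & shiftS h T] = [disjoint S & T].
  apply/fdisjointP/fdisjointP => dST t.
    move=> tS; have := dST (h + t)%N (in_imfset _ _ tS); apply: contra => tT.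
    exact: in_imfset.
  case/imfsetP => u uS ->; apply: contra (dST u uS) => /imfsetP[v vT /addnI->]; exact:
      vT.
case: ifP => // _; congr (_ ^+ _); rewrite /gr_inv (perm_big _ (perm_shiftS h S))
    big_map.
apply: eq_bigr => u _; rewrite (perm_big _ (perm_shiftS h T)) big_map.
by apply: eq_bigr => v _; rewrite ltn_add2l.
Qed.

Lemma shiftSU h S T : shiftS h (S `|` T) = shiftS h S `|` shiftS h T.
Proof. exact: imfsetU. Qed.

(** The endomorphism sending each e_t to e_(h+t); it moves a value to generators absent from another
    one. *)
Definition gr_shift h x : E := \sum_(S <- msupp x) << x@_S *g shiftS h S >>.

Lemma gr_shiftEw h (d : {fset {fset nat}}) x : msupp x `<=` d ->
  gr_shift h x = \sum_(S <- d) << x@_S *g shiftS h S >>.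
Proof.
move=> le; rewrite /gr_shift (big_fset_incl _ le) //= => S _ /mcoeff_outdom ->.
by rewrite monalgU0.
Qed.

Lemma gr_shiftD h x y : gr_shift h (x + y) = gr_shift h x + gr_shift h y.
Proof.
rewrite (gr_shiftEw h (msuppD_le x y)) (gr_shiftEw h (fsubsetUl _ (msupp y))).
rewrite (gr_shiftEw h (fsubsetUr (msupp x) (msupp y))) -big_split /=.
by apply: eq_bigr => S _; rewrite mcoeffD monalgUD.
Qed.

Lemma gr_shiftU h c S : gr_shift h (<< c *g S >> : E) = << c *g shiftS h S >>.
Proof. by rewrite (gr_shiftEw h msuppU_le) big_seq_fset1 mcoeffUU. Qed.

Lemma gr_shiftZ h c x : gr_shift h (c *: x) = c *: gr_shift h x.
Proof.
rewrite (gr_shiftEw h (msuppZ_le c x)) scaler_sumr.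
by apply: eq_bigr => S _; rewrite gr_scaleU mcoeffZ.
Qed.

Lemma gr_shift0 h : gr_shift h 0 = 0.
Proof. by rewrite /gr_shift msupp0 big_seq_fset0. Qed.

Lemma gr_shift_sum h I (r : seq I) (G : I -> E) :
  gr_shift h (\sum_(i <- r) G i) = \sum_(i <- r) gr_shift h (G i).
Proof. exact: (big_morph _ (gr_shiftD h) (gr_shift0 h)). Qed.

Lemma gr_shift_mon h S : gr_shift h (gr_mon F S) = gr_mon F (shiftS h S).
Proof. exact: gr_shiftU. Qed.

Lemma gr_shift1 h : gr_shift h 1 = 1.
Proof. by rewrite [LHS]gr_shift_mon /shiftS imfset0. Qed.

Lemma gr_shiftM h x y : gr_shift h (x * y) = gr_shift h x * gr_shift h y.
Proof.
have UU c d S T : gr_shift h ((<< c *g S >> : E) * << d *g T >>) =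
    gr_shift h << c *g S >> * gr_shift h << d *g T >>.
  have mulUU c' d' S' T' : (<< c' *g S' >> : E) * << d' *g T' >> =
      << c' * d' * gr_sign F S' T' *g S' `|` T' >> by exact: gr_mulUU.
  by rewrite mulUU !gr_shiftU mulUU gr_sign_shift shiftSU.
have UM c S : gr_shift h ((<< c *g S >> : E) * y) = gr_shift h << c *g S >> * gr_shift
    h y.
  rewrite [y]monalgE [in LHS]mulr_sumr !gr_shift_sum [RHS]mulr_sumr.
  by apply: eq_bigr => T _; apply: UU.
rewrite [x]monalgE [in LHS]mulr_suml !gr_shift_sum [RHS]mulr_suml.
by apply: eq_bigr => S _; apply: UM.
Qed.

Lemma mcoeff_shift h x S : (gr_shift h x)@_(shiftS h S) = x@_S.
Proof.
have l : msupp x `<=` S |` msupp x by apply: fsubsetUr.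
rewrite (gr_shiftEw h l) raddf_sum (bigD1_seq S) ?fset1U1 ?fset_uniq //=.
rewrite mcoeffUU big1 ?addr0 // => T TS.
by rewrite mcoeffU (inj_eq (@shiftS_inj h)) (negPf TS).
Qed.

Lemma msupp_shift h x U t : U \in msupp (gr_shift h x) -> t \in U -> (h <= t)%N.
Proof.
rewrite -mcoeff_neq0 /gr_shift raddf_sum /= => nz tU; apply: contraNT nz => nht.
apply/eqP/big1 => S _; rewrite mcoeffU; case: eqP => // E; case/negP: nht.
by apply: (@mem_shiftS h S); rewrite E.
Qed.

Lemma gr_homog_shift h b x : x \in gr_homog F b -> gr_shift h x \in gr_homog F b.
Proof.
move=> /allP xb; rewrite /gr_shift big_seq rpred_sum // => S /xb /eqP Sb.
apply/gr_homogP => U Ub; rewrite mcoeffU; case: eqP => // E; case/negP: Ub.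
by rewrite -E card_shiftS Sb.
Qed.

End Coefficients.

(** Since n n = 0, the inverse of 1 + n is 1 - n, so conjugation by 1 + n commutes with evaluation;
    the quadratic term n P n of the conjugate vanishes. *)
Lemma peval_unipotent (F : fieldType) (A : algType F) (n : A) (a : nat -> A) (f :
    freealg F) :
    n * n = 0 -> n * peval a f * n = 0 ->
  peval (fun k => (1 + n) * a k * (1 - n)) f = peval a f + n * peval a f - peval a f *
      n.
Proof.
move=> nn nPn; have vu : (1 - n) * (1 + n) = 1.
  by rewrite mulrDr mulr1 mulrBl mul1r nn subr0 subrK.
have uv : (1 + n) * (1 - n) = 1 by rewrite mulrBr mulr1 mulrDl mul1r nn addr0 addrK.
transitivity ((1 + n) * peval a f * (1 - n)); last first.
  by rewrite mulrBr mulr1 !mulrDl mul1r nPn addr0.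
apply: esym; apply: (peval_morph (phi := fun x : A => (1 + n) * x * (1 - n))).
- by move=> x y; rewrite [(1 + n) * (x + y)]mulrDr [LHS]mulrDl.
- by move=> x y; rewrite !mulrA -[_ * (1 - n) * (1 + n)]mulrA vu mulr1.
- by rewrite mulr1 uv.
- by move=> k x; rewrite -scalerAr -scalerAl.
Qed.

(** * Coefficient matrices of central values *)

Section Primeness.
Variables (F : fieldType) (m : nat) (s : bool) (par : 'I_m.+1 -> bool).
Local Notation E := (grassmann F).
Local Notation I := 'I_m.+1.
Local Notation B := (matalg E m).
Local Notation typed := (@typed F m s par).
Hypothesis n2 : 2%:R != 0 :> F.
Hypothesis par_onto : forall j, exists i, s || (par i != par j).

Definition mon_coef (S : {fset nat}) (M : 'M[E]_m.+1) : 'M[F]_m.+1 :=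
  map_mx (fun x : E => x@_S) M.

(** The condition that centrality of a typed matrix puts on its coefficient at e_S, with [b] the
    parity of |S|. *)
Definition super_scalar (b : bool) (C : 'M[F]_m.+1) :=
  is_scalar_mx C /\ (b -> C = 0).

Lemma mon_coef_typed S M i j : typed M -> ~~ s -> odd #|` S| != par i (+) par j ->
  mon_coef S M i j = 0.
Proof.
by move=> /(_ i j) + s0; rewrite /entry_ok (negPf s0) mxE => /gr_homogP; apply.
Qed.

(** The second hypothesis compares the entries of (-1)^b N C and C N for the odd matrix units N, or
    for all of them if [s] holds. It kills the off-diagonal entries and relates the diagonal ones;
    for odd [b] these vanish by C_ii = - C_ii or by the first hypothesis. *)
Lemma super_scalarP b (C : 'M[F]_m.+1) :
    (forall i j, ~~ s -> b != par i (+) par j -> C i j = 0) ->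
    (forall i j, s || (par i != par j) -> forall a c,
       (-1) ^+ b * C j c *+ (a == i) = C a i *+ (c == j)) ->
  super_scalar b C.
Proof.
move=> Ctyped H.
have off j c : c != j -> C j c = 0.
  move=> cj; have [i ij] := par_onto j; have := H i j ij i c.
  by rewrite eqxx (negPf cj) => /eqP; rewrite mulf_eq0 signr_eq0 => /eqP.
have diag i j : s || (par i != par j) -> (-1) ^+ b * C j j = C i i.
  by move=> ij; have := H i j ij i j; rewrite !eqxx.
have C0 : b -> C = 0.
  case: b Ctyped H diag => // Ctyped _ diag _; apply/matrixP => i j; rewrite mxE.
  have [<-|ij] := eqVneq i j; last by apply: off; rewrite eq_sym.
  have [s1|s0] := boolP s; last by apply: Ctyped; rewrite // addbb.
  have := diag i i; rewrite s1 => /(_ isT)/eqP.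
  by rewrite expr1 mulN1r eq_sym -addr_eq0 -mulr2n -mulr_natl mulf_eq0 (negPf n2) =>
      /eqP.
split=> //; case: b C0 diag {Ctyped H} => [C0 _|_ diag].
  by rewrite C0 //; apply/is_scalar_mxP; exists 0; apply/matrixP => i j; rewrite !mxE
      mul0rn.
apply/is_scalar_mxP; exists (C ord0 ord0); apply/matrixP => i j; rewrite mxE.
have [<-|ij] := eqVneq i j; last by rewrite mulr0n off // eq_sym.
have diag' a c : s || (par a != par c) -> C c c = C a a.
  by move/diag; rewrite mul1r.
have [s1|s0] := boolP s; first by apply: diag'; rewrite s1.
have [p0|p0] := boolP (par ord0 != par i); first by apply: diag'; rewrite p0 orbT.
(* Two indices of the same block are compared through an index [k] of the other block. *)
have [k] := par_onto i; rewrite (negPf s0) /= => ki.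
rewrite (diag' k i) ?ki ?orbT // -(diag' k ord0) // (eqP (negPn p0)) .
by rewrite ki orbT.
Qed.

Definition mx_lt (M : 'M[E]_m.+1) h := forall i j, gr_lt (M i j) h.

Lemma mx_lt_exists M S : exists h, mx_lt M h /\ fset_lt S h.
Proof.
have /fin_all_exists[h0 hP] (q : I * I) : exists h0, forall h, (h0 <= h)%N ->
    gr_lt (M q.1 q.2) h /\ fset_lt S h by apply: gr_lt_exists.
exists (\max_q h0 q)%N; split=> [i j|]; first by have [] := hP (i, j) _ (leq_bigmax _).
by have [] := hP (ord0, ord0) _ (leq_bigmax _).
Qed.

Lemma elem_mx_mulr (g : E) i j (M : 'M[E]_m.+1) a c : (elem_mx g i j * M) a c = g * M
    j c *+ (a == i).
Proof.
rewrite mxE (bigD1 j) //= big1 ?addr0 => [|k kj].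
  by rewrite mxE eqxx andbT mulrnAl.
by rewrite mxE (negPf kj) andbF mul0r.
Qed.

Lemma elem_mx_mull (g : E) i j (M : 'M[E]_m.+1) a c : (M * elem_mx g i j) a c = M a i
    * g *+ (c == j).
Proof.
rewrite mxE (bigD1 i) //= big1 ?addr0 => [|k ki].
  by rewrite mxE eqxx mulrnAr.
by rewrite mxE (negPf ki) mulr0.
Qed.

Lemma mcoeff_elem_mx_mulr M S h i j a c : mx_lt M h -> fset_lt S h ->
  ((elem_mx (gr_gen F h) i j * M) a c)@_(S `|` [fset h]) =
    (-1) ^+ odd #|` S| * mon_coef S M j c *+ (a == i).
Proof. by move=> Mh Sh; rewrite elem_mx_mulr mcoeffMn mcoeff_genM ?mxE. Qed.

Lemma mcoeff_elem_mx_mull M S h i j a c : mx_lt M h -> fset_lt S h ->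
  ((M * elem_mx (gr_gen F h) i j) a c)@_(S `|` [fset h]) = mon_coef S M a i *+ (c == j).
Proof. by move=> Mh Sh; rewrite elem_mx_mull mcoeffMn mcoeff_Mgen ?mxE. Qed.

Lemma typed_gen h i j : s || (par i != par j) -> typed (elem_mx (gr_gen F h) i j).
Proof.
move=> ij; apply: typed_elem_mx; rewrite /entry_ok.
case: s ij => //= ij; have -> : par i (+) par j by case: (par i) (par j) ij => [] [].
exact: gr_gen_homog.
Qed.

(** Commute [M] with e_h N, where N is an admissible matrix unit and e_h is absent from [M] and e_S,
    and compare the coefficients at e_S e_h. *)
Lemma central_mon_coef (M : 'M[E]_m.+1) : typed M -> (forall N : 'M[E]_m.+1, typed N
    -> M * N = N * M) ->
  forall S, super_scalar (odd #|` S|) (mon_coef S M).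
Proof.
move=> MP MC S; apply: super_scalarP => [i j s0 nij|i j ij a c]; first exact:
    mon_coef_typed.
have [h [Mh Sh]] := mx_lt_exists M S.
have /matrixP/(_ a c)/(congr1 (mcoeff (S `|` [fset h]))) := MC _ (typed_gen h ij).
move=> E; apply: etrans (esym (mcoeff_elem_mx_mulr i j a c Mh Sh)) _.
exact: etrans (esym E) (mcoeff_elem_mx_mull i j a c Mh Sh).
Qed.

(** All coefficients being scalar, [M] is a scalar matrix, and its diagonal entry is even, hence
    central in [E]. *)
Lemma mon_coef_central (M : 'M[E]_m.+1) : (forall S, super_scalar (odd #|` S|)
    (mon_coef S M)) ->
  forall N : 'M[E]_m.+1, M * N = N * M.
Proof.
move=> MS N; have ME : M = (M ord0 ord0)%:M.
  apply/matrixP => i j; rewrite [RHS]mxE; apply/malgP => S.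
  have [/is_scalar_mxP[k /matrixP kE] _] := MS S.
  by move: (kE i j) (kE ord0 ord0); rewrite mcoeffMn !mxE eqxx mulr1n => -> ->.
rewrite ME; apply: scalar_mx_central => c; apply: gr_even_central; apply/gr_homogP =>
    S So.
have [_ /(_ _)/matrixP/(_ ord0 ord0)] := MS S.
by rewrite !mxE; apply; case: (odd _) So.
Qed.

Lemma typed_prod (r : seq nat) (a : nat -> B) : (forall i, typed (a i)) ->
  typed (\prod_(i <- r) a i).
Proof.
by move=> aP; elim/big_ind: _ => // [|M N]; [apply: typed1|apply: typedM].
Qed.

Lemma typed_peval (a : nat -> B) f : (forall i, typed (a i)) -> typed (peval a f).
Proof.
move=> aP; apply: typed_sum => k; apply: typedM (typed_prod _ aP).
move=> i j; rewrite mxE [X in _ *: X]mxE; case: eqP => [->|_]; first exact: entry_okA.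
by rewrite scaler0 entry_ok0.
Qed.

(* Conjugating a value P of f by 1 + e_h N, with e_h a generator absent from P,
   adds e_h N P - P e_h N, whose monomials have the parity excluded by the
   hypothesis; hence P supercommutes with the odd matrix units N. *)
Lemma value_central f p :
    (forall (a : nat -> B), (forall i, typed (a i)) -> forall S, odd #|` S| != p ->
       mon_coef S (peval a f) = 0) ->
  tcentral s par f.
Proof.
move=> H a aP M _; apply: mon_coef_central => S.
have PP := typed_peval f aP; have Pv := H a aP; set P := peval a f in PP Pv *.
have [Sp|Sp] := eqVneq (odd #|` S|) p; last first.
  rewrite Pv //; split=> //; apply/is_scalar_mxP; exists 0.
  by apply/matrixP => i j; rewrite !mxE mul0rn.
apply: super_scalarP => [i j s0 nij|i j ij b c]; first exact: mon_coef_typed.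
have [h [Ph Sh]] := mx_lt_exists P S.
pose n : B := elem_mx (gr_gen F h) i j.
have nP : typed n by apply: typed_gen.
have nn : n * n = 0.
  by apply/matrixP => x y; rewrite elem_mx_mulr !mxE mulrnAr gr_gen_sq !mul0rn.
have nPn : n * P * n = 0.
  apply/matrixP => x y; rewrite elem_mx_mull elem_mx_mulr mulrnAl.
  by rewrite gr_gen_sandwich !mul0rn mxE.
have PE := peval_unipotent nn nPn; set a' := fun k => _ in PE.
have a'P k : typed (a' k).
  apply: typedM; [apply: typedM => //; apply: typedD|apply: typedB] => //; exact:
      typed1.
have Shp : odd #|` S `|` [fset h]| != p.
  rewrite cardfsU cardfs1 (_ : S `&` [fset h] = fset0) ?cardfs0 ?subn0 ?addn1 /= ?Sp.
    by case: (p).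
  apply/fsetP => t; rewrite in_fsetI in_fset1 in_fset0; case: eqP => [->|]; rewrite
      ?andbF //.
  by rewrite andbT; apply/negP => /Sh; rewrite ltnn.
have := H _ a'P _ Shp; rewrite PE => /matrixP/(_ b c); rewrite [RHS]mxE mxE.
have entry (X Y Z : 'M[E]_m.+1) : (X + Y - Z) b c = X b c + Y b c - Z b c by rewrite
    !mxE.
have P0 : (P b c)@_(S `|` [fset h]) = 0.
  apply/mcoeff_outdom/negP => /(Ph b c) /(_ h).
  by rewrite in_fsetU in_fset1 eqxx orbT ltnn => /(_ isT).
rewrite [X in X@_ _]entry mcoeffB mcoeffD P0 add0r => /eqP; rewrite subr_eq0 => /eqP
    nPE.
apply: etrans (esym (mcoeff_elem_mx_mulr i j b c Ph Sh)) (etrans nPE _).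
exact: mcoeff_elem_mx_mull.
Qed.

End Primeness.

(** * Products of values *)

Section Product.
Variables (F : fieldType) (m : nat).
Local Notation E := (grassmann F).
Local Notation B := (matalg E m).
Implicit Types (P Q : 'M[E]_m.+1).

Definition mx_shift h P : 'M[E]_m.+1 := map_mx (gr_shift h) P.

Lemma mx_shiftD h P Q : mx_shift h (P + Q) = mx_shift h P + mx_shift h Q.
Proof. by apply/matrixP => i j; rewrite !mxE gr_shiftD. Qed.

Lemma mx_shiftM h P Q : mx_shift h (P * Q) = mx_shift h P * mx_shift h Q.
Proof.
apply/matrixP => i j; rewrite !mxE gr_shift_sum.
by apply: eq_bigr => k _; rewrite gr_shiftM !mxE.
Qed.

Lemma mx_shift1 h : mx_shift h 1 = 1.
Proof.
apply/matrixP => i j; rewrite !mxE; case: (i == j); first exact: gr_shift1.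
exact: gr_shift0.
Qed.

Lemma mx_shiftZ h c (P : B) : mx_shift h (c *: P) = c *: (mx_shift h P : B).
Proof. by apply/matrixP => i j; rewrite !mxE gr_shiftZ. Qed.

Lemma mon_coef_mul_shift P Q h S T : mx_lt P h -> fset_lt S h ->
  mon_coef (S `|` shiftS h T) (P * mx_shift h Q) = mon_coef S P * mon_coef T Q.
Proof.
move=> Ph Sh; apply/matrixP => i j; rewrite !mxE raddf_sum; apply: eq_bigr => k _ /=.
rewrite (mcoeffM_lt (Ph i k) Sh) ?mxE ?mcoeff_shift // => [U|]; last exact: mem_shiftS.
by move=> Uy t; apply: msupp_shift Uy.
Qed.

(** Every coefficient of P Q is a signed sum of products P_S Q_T. One finite set [supp] bounds the
    supports of all entries, which allows the sums to be exchanged. *)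
Lemma mul_mon_coef0 P Q : (forall S T, mon_coef S P * mon_coef T Q = 0) -> P * Q = 0.
Proof.
move=> H; pose supp (M : 'M[E]_m.+1) := \bigcup_(q <- index_enum ('I_m.+1 *
    'I_m.+1)%type)
  msupp (M q.1 q.2).
have sP (M : 'M[E]_m.+1) i j : msupp (M i j) `<=` supp M.
  have ijr : (i, j) \in index_enum ('I_m.+1 * 'I_m.+1)%type by rewrite mem_index_enum.
  exact: (bigfcup_sup (P := xpredT) (fun q => msupp (M q.1 q.2)) ijr).
apply/matrixP => i j; rewrite [RHS]mxE; apply/malgP => U; rewrite mxE raddf_sum
    mcoeff0 /=.
under eq_bigr => k _ do rewrite (mcoeffM U (sP P i k) (sP Q k j)).
rewrite exchange_big big1 //= => S _; rewrite exchange_big big1 //= => T _.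
rewrite sumrMnl -mulr_suml; have /matrixP/(_ i j) := H S T; rewrite !mxE.
by under eq_bigr do rewrite !mxE; move=> ->; rewrite mul0r mul0rn.
Qed.

Lemma typed_shift s par h P : typed s par P -> typed s par (mx_shift h P).
Proof.
move=> PP i j; move: (PP i j); rewrite mxE /entry_ok; case: s {PP} => //=.
exact: gr_homog_shift.
Qed.

End Product.

(** * Centrality of both factors *)

Section TypedPrimeness.
Variables (F : fieldType) (m : nat) (s : bool) (par : 'I_m.+1 -> bool).
Local Notation E := (grassmann F).
Local Notation B := (matalg E m).
Local Notation typed := (@typed F m s par).
Hypothesis n2 : 2%:R != 0 :> F.
Hypothesis par_onto : forall j, exists i, s || (par i != par j).

Lemma typed_primeness (r t : nat) (f g : freealg F) :
    in_vars [pred i | (i < r)%N] f -> in_vars [pred i | (r <= i < t)%N] g ->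
    tcentral s par (f * g) -> ~ tident s par (f * g) ->
  tcentral s par f /\ tcentral s par g.
Proof.
move=> fr gt fgc fgi.
have prodP (a b : nat -> B) : (forall i, typed (a i)) -> (forall i, typed (b i)) ->
    forall S T, super_scalar (odd #|` S| (+) odd #|` T|)
      (mon_coef S (peval a f) * mon_coef T (peval b g)).
  move=> aP bP S T; have [h [Ph Sh]] := mx_lt_exists (peval a f) S.
  (* The variables being disjoint, one assignment gives [f] its value at [a] and [g] its value at
     [b] with generators renamed past those of the former. *)
  pose c i : B := if (i < r)%N then a i else mx_shift h (b i).
  have cP i : typed (c i) by rewrite /c; case: ifP => // _; apply: typed_shift.
  have fE : peval c f = peval a f by apply: peval_in_vars fr _ => i /= ir; rewrite /c
      ir.
  have gE : peval c g = mx_shift h (peval b g).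
    rewrite (peval_morph (phi := mx_shift h : B -> B)).
    - by apply: peval_in_vars gt _ => i /= /andP[ri _]; rewrite /c ltnNge ri.
    - exact: mx_shiftD.
    - exact: mx_shiftM.
    - exact: mx_shift1.
    - exact: mx_shiftZ.
  have := central_mon_coef n2 par_onto (typed_peval (f * g) cP) (fgc c cP) (S `|`
      shiftS h T).
  have E1 : mon_coef (S `|` shiftS h T) (peval c (f * g)) = mon_coef S (peval a f) *
      mon_coef T (peval b g).
    apply: etrans (congr1 _ (pevalM c f g)) _; apply: etrans (mon_coef_mul_shift _ _
        Ph Sh).
    by rewrite fE gE.
  by rewrite E1 odd_card_shiftS.
(* Equality in B is decidable, so it may be derived from the existence of a
   nonzero product of coefficients of values of f and g. *)
have {fgi} reduce (X Y : B) :
  (forall c : nat -> B, (forall i, typed (c i)) -> forall S T,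
     mon_coef S (peval c f) * mon_coef T (peval c g) != 0 -> X = Y) -> X = Y.
  move=> H; apply/eqP/negPn/negP => nXY; apply: fgi => c cP; rewrite pevalM.
  apply: mul_mon_coef0 => S T; apply/eqP/negPn/negP => /(H c cP) E0.
  by rewrite E0 eqxx in nXY.
(* A nonzero scalar product of square matrices makes both factors invertible, and it forces the
   parity [b] to be even. *)
have inv (C D : 'M[F]_m.+1) b : super_scalar b (C * D) -> C * D != 0 ->
  [/\ ~~ b, forall X : 'M[F]_m.+1, X * D = 0 -> X = 0
    & forall X : 'M[F]_m.+1, C * X = 0 -> X = 0].
  case=> /is_scalar_mxP[k CD] b0 nz.
  have k0 : k != 0 by apply: contraNneq nz => k0; rewrite CD k0 raddf0.
  have CD1 : C *m (k^-1 *: D) = 1%:M.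
    by rewrite -scalemxAr [C *m D]CD scale_scalar_mx mulVf.
  have DC1 := mulmx1C CD1; split.
  - by apply/negP => /b0 CD0; rewrite CD0 eqxx in nz.
  - move=> X XD; rewrite -[X]mulmx1 -DC1 mulmxA -scalemxAr [X *m D]XD.
    by rewrite scaler0 mul0mx.
  - by move=> X CX; rewrite -[X]mul1mx -DC1 -mulmxA [C *m X]CX mulmx0.
split=> a aP M MP; apply: reduce => c cP S0 T0 nz;
    have [/negPf par0 Dinj Cinj] := inv _ _ _ (prodP c c cP cP S0 T0) nz.
  (* S0 and T0 have the same parity, so for S of the other parity the product of the coefficients at
     S and T0 is zero; the coefficient at T0 is invertible and can be cancelled. *)
  apply: (value_central n2 par_onto (p := odd #|` S0|)) => // b bP S SS0.
  apply: Dinj; have [_] := prodP b c bP cP S T0; apply.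
  by move: par0 SS0; case: (odd #|` S0|) (odd #|` T0|) (odd #|` S|) => [] [] [].
apply: (value_central n2 par_onto (p := odd #|` T0|)) => // b bP T TT0.
apply: Cinj; have [_] := prodP c b cP bP S0 T; apply.
by move: par0 TT0; case: (odd #|` S0|) (odd #|` T0|) (odd #|` T|) => [] [] [].
Qed.

End TypedPrimeness.

(** Each algebra enters through an embedding [iota] whose image is the set of typed matrices, with
    [kappa] as inverse on that image. *)
Lemma primeness_of_typed (F : fieldType) (charF0 : [pchar F] =i pred0) (m : nat)
    (s : bool) (par : 'I_m.+1 -> bool) (A : algType F)
    (iota : A -> matalg (grassmann F) m) (kappa : matalg (grassmann F) m -> A) :
    (forall j, exists i, s || (par i != par j)) ->
    (forall x y, iota (x + y) = iota x + iota y) ->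
    (forall x y, iota (x * y) = iota x * iota y) ->
    iota 1 = 1 -> (forall c x, iota (c *: x) = c *: iota x) -> injective iota ->
    (forall x, typed s par (iota x)) ->
    (forall M, typed s par M -> iota (kappa M) = M) ->
  primeness_property F A.
Proof.
move=> par_onto iD iM i1 iZ i_inj iT iK.
have n2 : 2%:R != 0 :> F by have /pcharf0P -> := charF0.
apply: (primeness_typed iD iM i1 iZ i_inj iT iK); first exact: typed_central_exists.
exact: typed_primeness.
Qed.

Theorem theorem3p7 (F : fieldType) (charF0 : [pchar F] =i pred0) (n : nat) :
  primeness_property F (matalg (grassmann F) n) /\
  primeness_property F (supermat F n).
Proof.
split.
  by apply: (@primeness_of_typed F charF0 n true (fun=> false) _ id id) => // j;
      exists j.
pose par (i : 'I_(n + n.+1).+1) := (i < n.+1)%N.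
have typedE (M : matalg (grassmann F) (n + n.+1)) :
    typed false par M <-> M \in block_even_odd F n.
  have neqE (a b : bool) : (a != b) = a (+) b by case: a b => [] [].
  split=> [MP|/block_even_oddP MP i j]; last by rewrite /entry_ok -neqE; apply: MP.
  by apply/block_even_oddP => i j; rewrite neqE; apply: MP.
(* [insubd 0] inverts the inclusion on [block_even_odd] and is 0 elsewhere. The indices [ord0] and
   [ord_max] show that both blocks are inhabited. *)
apply: (@primeness_of_typed F charF0 _ false par _ val (insubd 0)) => //.
- move=> j; have [jn|jn] := ltnP j n.+1; last first.
    by exists ord0; rewrite /par [(j < _)%N]ltnNge jn.
  by exists ord_max; rewrite /par jn ltnNge leq_addl.
- exact: val_inj.
- by case=> M MP; apply/typedE.
- by move=> M /typedE MP; rewrite insubdK.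
Qed.
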